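(* Let $\Gamma=\Delta(k_1,k_2,k_3)$ be a hyperbolic triangle group with geometric representation $\rho_{\mathrm{geom}}:\Gamma\to\mathrm{PGL}(2,\mathbb{R})\cong\mathrm{PSp}^\pm(2,\mathbb{R})$, and let $n\ge1$. Then for any pair of natural numbers $(p,q)$ with $p+q=n$ and the $(p,q)$-diagonal representation $i_{(p,q)}:\mathrm{PSp}^\pm(2,\mathbb{R})\to\mathrm{PSp}^\pm(2n,\mathbb{R})$, any deformation of $i_{(p,q)}\circ\rho_{\mathrm{geom}}$ is conjugate to $i_{(p,q)}\circ\rho_{\mathrm{geom}}$; that is, if $(\rho_t)_{t\in[0,1]}$ is a continuous path of representations $\Gamma\to\mathrm{PSp}^\pm(2n,\mathbb{R})$ with $\rho_0=i_{(p,q)}\circ\rho_{\mathrm{geom}}$, then every $\rho_t$ is conjugate to $\rho_0$ by an element of $\mathrm{PSp}^\pm(2n,\mathbb{R})$. In particular, there are at least $\lceil\frac{n+1}{2}\rceil$ isolated points in the character variety \[\chi(\Gamma,\mathrm{PSp}^\pm(2n,\mathbb{R}))=\mathrm{Hom}(\Gamma,\mathrm{PSp}^\pm(2n,\mathbb{R}))/\mathrm{Inn}(\mathrm{PSp}^\pm(2n,\mathbb{R})).\]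
   Context: For positive integers $k_1,k_2,k_3$, $\Delta(k_1,k_2,k_3)=\langle a,b,c\mid a^2=b^2=c^2=(ab)^{k_1}=(bc)^{k_2}=(ac)^{k_3}=1\rangle$; it is called hyperbolic if $\frac1{k_1}+\frac1{k_2}+\frac1{k_3}<1$. Identify $\mathrm{PGL}(2,\mathbb{R})$ with the isometry group of the hyperbolic plane. The geometric representation $\rho_{\mathrm{geom}}$ maps $a,b,c$ to the reflections in the three sides of a hyperbolic triangle with interior angles $\frac{\pi}{k_1},\frac{\pi}{k_2},\frac{\pi}{k_3}$ (sides for $a,b$ meeting at angle $\pi/k_1$, for $b,c$ at $\pi/k_2$, for $a,c$ at $\pi/k_3$); it is unique up to conjugation. For a real symplectic vector space $(V,\omega)$ of dimension $2n$, $\mathrm{Sp}^\pm(V,\omega)=\mathrm{Sp}^\pm(2n,\mathbb{R})$ is the group of linear automorphisms $A$ of $V$ with $A^*\omega=\pm\omega$, and $\mathrm{PSp}^\pm(2n,\mathbb{R})=\mathrm{Sp}^\pm(2n,\mathbb{R})/\{\pm I\}$. One has $\mathrm{PGL}(2,\mathbb{R})\cong\mathrm{PSp}^\pm(2,\mathbb{R})$. Given a $2$-dimensional real symplectic vector space $(U,\omega)$ and an $n$-dimensional real vector space $(W,b)$ with a nondegenerate symmetric bilinear form $b$ of signature $(p,q)$, the space $U\otimes W$ with the form $\omega\otimes b$ is a symplectic vector space of dimension $2n$. The $(p,q)$-diagonal representation $i_{(p,q)}:\mathrm{PSp}^\pm(2,\mathbb{R})\to\mathrm{PSp}^\pm(2n,\mathbb{R})$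 is induced by $\mathrm{Sp}^\pm(U)\to\mathrm{Sp}^\pm(U\otimes W)$, $A\mapsto A\otimes \mathrm{id}_W$. $\mathrm{Hom}$ has the topology of pointwise convergence and the character variety the quotient topology, where inner automorphisms act by postcomposition (conjugation). *)

(* Defs.v *)
From HB Require Import structures.
From mathcomp Require Import all_boot all_order all_algebra.
From mathcomp Require Import all_classical all_reals all_analysis.
From mathcomp.real_closed Require Import complex mxtens.

Set Implicit Arguments.
Unset Strict Implicit.
Unset Printing Implicit Defensive.

Import Order.TTheory GRing.Theory Num.Theory.
Import numFieldNormedType.Exports.

Local Open Scope classical_set_scope.
Local Open Scope quotient_scope.
Local Open Scope ring_scope.

(** Groups given by generators and relations: words in the letters
    [(x, false)] (meaning x) and [(x, true)] (meaning x^-1), modulo the least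
    congruence that cancels inverse letters and kills the relators. *)
Section Presentation.
Variables (X : choiceType) (rels : set (seq (X * bool))).
Local Notation word := (seq (X * bool)).

Definition inv_word (w : word) : word := rev [seq (l.1, ~~ l.2) | l <- w].

Inductive pres_eq : word -> word -> Prop :=
| pres_refl u : pres_eq u u
| pres_sym u v : pres_eq u v -> pres_eq v u
| pres_trans u v w : pres_eq u v -> pres_eq v w -> pres_eq u w
| pres_cat u u' v v' : pres_eq u u' -> pres_eq v v' -> pres_eq (u ++ v) (u' ++ v')
| pres_cancel x e : pres_eq [:: (x, e); (x, ~~ e)] [::]
| pres_relator r : rels r -> pres_eq r [::].

Definition pres_rel : rel word := fun u v => `[< pres_eq u v >].

Lemma pres_rel_refl : reflexive pres_rel.
Proof. by move=> u; apply/asboolP; exact: pres_refl. Qed.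

Lemma pres_rel_sym : symmetric pres_rel.
Proof. by move=> u v; apply/asboolP/asboolP; exact: pres_sym. Qed.

Lemma pres_rel_trans : transitive pres_rel.
Proof.
by move=> v u w /asboolP uv /asboolP vw; apply/asboolP; exact: pres_trans uv vw.
Qed.

Canonical pres_equiv := EquivRel pres_rel pres_rel_refl pres_rel_sym pres_rel_trans.

Definition presented := {eq_quot pres_equiv}.
HB.instance Definition _ := Choice.on presented.

Definition pres_class (w : word) : presented := \pi_{eq_quot pres_equiv} w.
Definition pres_repr (x : presented) : word := @repr _ {eq_quot pres_equiv} x.

Lemma pres_reprK x : pres_class (pres_repr x) = x.
Proof. exact: reprK. Qed.

Lemma pres_classP u v : pres_eq u v <-> pres_class u = pres_class v.
Proof.
by split=> [uv|/eqmodP /asboolP //]; apply/eqmodP; exact/asboolP.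
Qed.

Lemma pres_repr_class w : pres_eq (pres_repr (pres_class w)) w.
Proof. by apply/pres_classP; exact: pres_reprK. Qed.

Definition pres_mul (x y : presented) := pres_class (pres_repr x ++ pres_repr y).
Definition pres_one := pres_class [::].
Definition pres_inv (x : presented) := pres_class (inv_word (pres_repr x)).

Lemma pres_classM u v : pres_class (u ++ v) = pres_mul (pres_class u) (pres_class v).
Proof.
by apply/pres_classP; apply: pres_cat; apply: pres_sym; exact: pres_repr_class.
Qed.

Lemma inv_wordK : involutive inv_word.
Proof.
move=> w; rewrite /inv_word map_rev revK -map_comp -[RHS]map_id.
by apply: eq_map => -[x e] /=; rewrite negbK.
Qed.

Lemma pres_invwl u : pres_eq (inv_word u ++ u) [::].
Proof.
elim: u => [|[x e] u IH]; first exact: pres_refl.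
rewrite /inv_word /= rev_cons -cats1 -catA /= -/(inv_word u).
apply: pres_trans IH; apply: pres_cat; first exact: pres_refl.
rewrite -[u in X in pres_eq _ X]cat0s.
rewrite -[[:: _, _ & u]]/([:: (x, ~~ e); (x, e)] ++ u).
apply: pres_cat; last exact: pres_refl.
by rewrite -{2}[e]negbK; exact: pres_cancel.
Qed.

Lemma pres_invwr u : pres_eq (u ++ inv_word u) [::].
Proof. by rewrite -{1}[u]inv_wordK; exact: pres_invwl. Qed.

Lemma pres_mulA : associative pres_mul.
Proof.
move=> x y z; rewrite -[x]pres_reprK -[y]pres_reprK -[z]pres_reprK.
by rewrite -!pres_classM catA.
Qed.

Lemma pres_mul1 : left_id pres_one pres_mul.
Proof. by move=> x; rewrite -[x]pres_reprK -pres_classM. Qed.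

Lemma pres_mulr1 : right_id pres_one pres_mul.
Proof. by move=> x; rewrite -[x]pres_reprK -pres_classM cats0. Qed.

Lemma pres_mulV : left_inverse pres_one pres_inv pres_mul.
Proof.
move=> x; rewrite -{2}[x]pres_reprK -pres_classM.
by apply/pres_classP; exact: pres_invwl.
Qed.

Lemma pres_mulrV : right_inverse pres_one pres_inv pres_mul.
Proof.
move=> x; rewrite -{1}[x]pres_reprK -pres_classM.
by apply/pres_classP; exact: pres_invwr.
Qed.

HB.instance Definition _ :=
  isGroup.Build presented pres_mulA pres_mul1 pres_mulr1 pres_mulV pres_mulrV.

End Presentation.

Section TriangleGroup.
Variables k1 k2 k3 : nat.

Definition letter_a : 'I_3 * bool := (0, false).
Definition letter_b : 'I_3 * bool := (1, false).
Definition letter_c : 'I_3 * bool := (2, false).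

Definition word_pow (k : nat) (w : seq ('I_3 * bool)) := flatten (nseq k w).

Definition triangle_relators : set (seq ('I_3 * bool)) :=
  [set w | w \in [:: word_pow 2 [:: letter_a]; word_pow 2 [:: letter_b];
                     word_pow 2 [:: letter_c];
                     word_pow k1 [:: letter_a; letter_b];
                     word_pow k2 [:: letter_b; letter_c];
                     word_pow k3 [:: letter_a; letter_c]]].

Definition triangle_group : groupType := presented triangle_relators.

Definition tri_a : triangle_group := pres_class triangle_relators [:: letter_a].
Definition tri_b : triangle_group := pres_class triangle_relators [:: letter_b].
Definition tri_c : triangle_group := pres_class triangle_relators [:: letter_c].

Definition hyperbolic_triple : Prop :=
  [/\ (0 < k1)%N, (0 < k2)%N, (0 < k3)%N
    & k1%:R^-1 + k2%:R^-1 + k3%:R^-1 < 1 :> rat].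

End TriangleGroup.

(** Bilinear forms are given by their Gram matrices and linear maps act on
    column vectors, so the pull-back A^* Om is A^T *m Om *m A. *)
Section SymplecticGroup.
Variables (R : realType) (m : nat) (Om : 'M[R]_m).

Definition Sp_set : set 'M[R]_m :=
  [set A | A \in unitmx /\ (A^T *m Om *m A = Om \/ A^T *m Om *m A = - Om)].

Definition Sp_pm := set_type Sp_set.
HB.instance Definition _ := Topological.on Sp_pm.

Lemma Sp_pmP (A : Sp_pm) : Sp_set (val A).
Proof. by case: A => A /= /set_mem. Qed.

Definition mkSp (A : 'M[R]_m) (hA : Sp_set A) : Sp_pm := exist _ A (mem_set hA).

Lemma Sp_mul_subproof A B : Sp_set A -> Sp_set B -> Sp_set (A *m B).
Proof.
move=> [uA hA] [uB hB]; split; first by rewrite unitmx_mul uA uB.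
have -> : (A *m B)^T *m Om *m (A *m B) = B^T *m (A^T *m Om *m A) *m B.
  by rewrite trmx_mul !mulmxA.
by case: hA => ->; case: hB => hB; rewrite ?mulmxN ?mulNmx hB ?opprK; auto.
Qed.

Lemma Sp_one_subproof : Sp_set 1%:M.
Proof. by split; [exact: unitmx1 | left; rewrite trmx1 mul1mx mulmx1]. Qed.

Lemma Sp_inv_subproof A : Sp_set A -> Sp_set (invmx A).
Proof.
move=> [uA hA]; split; first by rewrite unitmx_inv.
have uAT : A^T \in unitmx by rewrite unitmx_tr.
have E (s : 'M[R]_m) : A^T *m Om *m A = s -> Om = (invmx A)^T *m s *m invmx A.
  by move=> <-; rewrite !mulmxA mulmxK // trmx_inv mulVmx // mul1mx.
case: hA => /E h; [left | right]; first by rewrite -h.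
by rewrite [in RHS]h mulmxN mulNmx opprK.
Qed.

Definition Sp_mul (A B : Sp_pm) := mkSp (Sp_mul_subproof (Sp_pmP A) (Sp_pmP B)).
Definition Sp_one := mkSp Sp_one_subproof.
Definition Sp_inv (A : Sp_pm) := mkSp (Sp_inv_subproof (Sp_pmP A)).

Lemma Sp_mulA : associative Sp_mul.
Proof. by move=> A B C; apply/val_inj; rewrite /= mulmxA. Qed.

Lemma Sp_mul1 : left_id Sp_one Sp_mul.
Proof. by move=> A; apply/val_inj; rewrite /= mul1mx. Qed.

Lemma Sp_mulr1 : right_id Sp_one Sp_mul.
Proof. by move=> A; apply/val_inj; rewrite /= mulmx1. Qed.

Lemma Sp_mulV : left_inverse Sp_one Sp_inv Sp_mul.
Proof. by move=> A; apply/val_inj; rewrite /= mulVmx //; case: (Sp_pmP A). Qed.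

Lemma Sp_mulrV : right_inverse Sp_one Sp_inv Sp_mul.
Proof. by move=> A; apply/val_inj; rewrite /= mulmxV //; case: (Sp_pmP A). Qed.

HB.instance Definition _ :=
  isGroup.Build Sp_pm Sp_mulA Sp_mul1 Sp_mulr1 Sp_mulV Sp_mulrV.

Definition pm_rel : rel Sp_pm := fun A B => (val A == val B) || (val A == - val B).

Lemma pm_rel_refl : reflexive pm_rel.
Proof. by move=> A; rewrite /pm_rel eqxx. Qed.

Lemma pm_rel_sym : symmetric pm_rel.
Proof. by move=> A B; rewrite /pm_rel eq_sym -eqr_oppLR (eq_sym (- _)). Qed.

Lemma pm_rel_trans : transitive pm_rel.
Proof.
move=> B A C; rewrite /pm_rel => /orP[] /eqP -> /orP[] /eqP ->;
  by rewrite ?opprK eqxx ?orbT.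
Qed.

Canonical pm_equiv := EquivRel pm_rel pm_rel_refl pm_rel_sym pm_rel_trans.

Definition PSp_pm := quotient_topology {eq_quot pm_equiv}.
HB.instance Definition _ := Topological.on PSp_pm.

Definition PSp_class (A : Sp_pm) : PSp_pm := \pi_{eq_quot pm_equiv} A.
Definition PSp_repr (x : PSp_pm) : Sp_pm := @repr _ {eq_quot pm_equiv} x.

Lemma PSp_reprK x : PSp_class (PSp_repr x) = x.
Proof. exact: reprK. Qed.

Lemma PSp_classP A B : reflect (PSp_class A = PSp_class B) (pm_rel A B).
Proof. exact: eqmodP. Qed.

Lemma PSp_repr_class A : pm_rel (PSp_repr (PSp_class A)) A.
Proof. by apply/PSp_classP; exact: PSp_reprK. Qed.

Definition PSp_mul (x y : PSp_pm) := PSp_class (Sp_mul (PSp_repr x) (PSp_repr y)).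
Definition PSp_one := PSp_class Sp_one.
Definition PSp_inv (x : PSp_pm) := PSp_class (Sp_inv (PSp_repr x)).

Lemma PSp_classM A B : PSp_class (Sp_mul A B) = PSp_mul (PSp_class A) (PSp_class B).
Proof.
apply/PSp_classP; rewrite pm_rel_sym /pm_rel /=.
have /orP[] := PSp_repr_class A; have /orP[] := PSp_repr_class B;
  by move=> /eqP -> /eqP ->; rewrite ?mulmxN ?mulNmx ?opprK eqxx ?orbT.
Qed.

Lemma PSp_mulA : associative PSp_mul.
Proof.
move=> x y z; rewrite -[x]PSp_reprK -[y]PSp_reprK -[z]PSp_reprK.
by rewrite -!PSp_classM Sp_mulA.
Qed.

Lemma PSp_mul1 : left_id PSp_one PSp_mul.
Proof. by move=> x; rewrite -[x]PSp_reprK -PSp_classM Sp_mul1. Qed.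

Lemma PSp_mulr1 : right_id PSp_one PSp_mul.
Proof. by move=> x; rewrite -[x]PSp_reprK -PSp_classM Sp_mulr1. Qed.

Lemma PSp_mulV : left_inverse PSp_one PSp_inv PSp_mul.
Proof. by move=> x; rewrite -{2}[x]PSp_reprK -PSp_classM Sp_mulV. Qed.

Lemma PSp_mulrV : right_inverse PSp_one PSp_inv PSp_mul.
Proof. by move=> x; rewrite -{1}[x]PSp_reprK -PSp_classM Sp_mulrV. Qed.

HB.instance Definition _ :=
  isGroup.Build PSp_pm PSp_mulA PSp_mul1 PSp_mulr1 PSp_mulV PSp_mulrV.

End SymplecticGroup.

Section CharacterVariety.
Variables (G : groupType) (R : realType) (m : nat) (Om : 'M[R]_m).

Definition HomSpace_set : set {ptws G -> PSp_pm Om} :=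
  [set f | forall x y, f (x * y)%g = (f x * f y)%g].

(* Topology of pointwise convergence, induced from [{ptws G -> PSp_pm Om}]. *)
Definition HomSpace := set_type HomSpace_set.
HB.instance Definition _ := Topological.on HomSpace.

Definition HomSpace_fun (rho : HomSpace) : G -> PSp_pm Om := val rho.
Coercion HomSpace_fun : HomSpace >-> Funclass.

Definition conjugate_rep (rho sigma : HomSpace) : Prop :=
  exists g : PSp_pm Om, forall x, sigma x = (g * rho x * g^-1)%g.

Definition conj_rel : rel HomSpace := fun rho sigma => `[< conjugate_rep rho sigma >].

Lemma conj_rel_refl : reflexive conj_rel.
Proof. by move=> r; apply/asboolP; exists 1%g => x; rewrite mul1g invg1 mulg1. Qed.

Lemma conj_rel_sym : symmetric conj_rel.
Proof.
have H r s : conjugate_rep r s -> conjugate_rep s r.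
  by move=> [g h]; exists g^-1%g => x; rewrite h invgK !mulgA mulVg mul1g -!mulgA mulVg mulg1.
by move=> r s; apply/asboolP/asboolP; exact: H.
Qed.

Lemma conj_rel_trans : transitive conj_rel.
Proof.
move=> s r t /asboolP[g hg] /asboolP[h hh]; apply/asboolP; exists (h * g)%g => x.
by rewrite hh hg invgM !mulgA.
Qed.

Canonical conj_equiv := EquivRel conj_rel conj_rel_refl conj_rel_sym conj_rel_trans.

Definition char_variety := quotient_topology {eq_quot conj_equiv}.
HB.instance Definition _ := Topological.on char_variety.

End CharacterVariety.

Section Diagonal.
Variable R : realType.

Definition omega2 : 'M[R]_2 := (block_mx 0 1 (-1) 0 : 'M[R]_(1 + 1)).

(* omega2 *t 1 (Kronecker product) is the block matrix ((0, I_n), (-I_n, 0)),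
   i.e. the standard symplectic form of R^2n. *)
Definition omega_std (n : nat) : 'M[R]_(2 * n) := omega2 *t 1%:M.

(* Sylvester normal form: some basis is b-orthogonal with p vectors of square 1
   and q vectors of square -1. *)
Definition has_signature (n : nat) (b : 'M[R]_n) (p q : nat) : Prop :=
  [/\ (p + q)%N = n, b^T = b
    & exists2 S : 'M[R]_n, S \in unitmx &
      S^T *m b *m S = diag_mx (\row_i (if (i < p)%N then 1 else -1))].

(* P is the matrix of a linear isomorphism U (x) W -> R^2n that carries the
   symplectic form omega2 (x) b to the standard one. *)
Definition symplectic_iso (n : nat) (b : 'M[R]_n) (P : 'M[R]_(2 * n)) : Prop :=
  P \in unitmx /\ P^T *m omega_std n *m P = omega2 *t b.

Section DiagRep.
Variables (n : nat) (b : 'M[R]_n) (P : 'M[R]_(2 * n)).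
Hypothesis hP : symplectic_iso b P.

Lemma diag_lift_subproof (A : Sp_pm omega2) :
  Sp_set (omega_std n) (P *m (val A *t (1%:M : 'M[R]_n)) *m invmx P).
Proof.
have [uP PE] := hP; have [uA AE] := Sp_pmP A.
have uPT : P^T \in unitmx by rewrite unitmx_tr.
have hform : (P *m (val A *t (1%:M : 'M[R]_n)) *m invmx P)^T *m omega_std n
    *m (P *m (val A *t (1%:M : 'M[R]_n)) *m invmx P)
  = (invmx P)^T *m (((val A)^T *m omega2 *m val A) *t b) *m invmx P.
  rewrite !trmx_mul !mulmxA -(mulmxA _ P^T) -(mulmxA _ (P^T *m _)) PE.
  rewrite trmx_tens trmx1 -!mulmxA; congr (_ *m _); rewrite !mulmxA.
  by rewrite !tensmx_mul mul1mx mulmx1.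
have back : (invmx P)^T *m (omega2 *t b) *m invmx P = omega_std n.
  by rewrite -PE !mulmxA mulmxK // trmx_inv mulVmx // mul1mx.
have tensN (X : 'M[R]_2) : (- X) *t b = - (X *t b).
  by apply/matrixP => i j; rewrite !mxE mulNr.
split.
  rewrite !unitmx_mul uP unitmx_inv uP andbT /=.
  have : (val A *t (1%:M : 'M[R]_n)) *m (invmx (val A) *t 1%:M) = 1%:M.
    rewrite tensmx_mul mulmxV // mulmx1; apply/matrixP => i j.
    case: (mxtens_indexP i) => i1 i2; case: (mxtens_indexP j) => j1 j2.
    rewrite tensmxE !mxE -natrM mulnb -xpair_eqE; congr (_ (nat_of_bool _)).
    by rewrite -(inj_eq (can_inj (@mxtens_indexK 2 n))).
  by case/mulmx1_unit.
rewrite hform; case: AE => ->; [left | right] => //.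
by rewrite tensN mulmxN mulNmx back.
Qed.

Definition diag_lift (A : Sp_pm omega2) : Sp_pm (omega_std n) :=
  mkSp (diag_lift_subproof A).

Definition diag_rep (x : PSp_pm omega2) : PSp_pm (omega_std n) :=
  PSp_class (diag_lift (PSp_repr x)).

Lemma diag_repE A : diag_rep (PSp_class A) = PSp_class (diag_lift A).
Proof.
apply/PSp_classP; rewrite /pm_rel /=.
have tensN (X : 'M[R]_2) : (- X) *t (1%:M : 'M[R]_n) = - (X *t 1%:M).
  by apply/matrixP => i j; rewrite !mxE mulNr.
have /orP[] := PSp_repr_class A => /eqP ->; first by rewrite eqxx.
by rewrite tensN mulmxN mulNmx eqxx orbT.
Qed.

End DiagRep.
End Diagonal.

(** The upper half-plane {z | 0 < Im z}; the class of a matrix of positive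
    (resp. negative) determinant acts by z |-> (a z + b) / (c z + d)
    (resp. by z |-> (a z^* + b) / (c z^* + d)).  This is the identification of
    PGL(2, R) = PSp^+-(2, R) with the isometry group of the hyperbolic plane:
    Sp^+-(2, R) is the group of matrices of determinant 1 or -1, so every class
    in PGL(2, R) has exactly two representatives, A and -A, in it. *)
Section HyperbolicPlane.
Variable R : realType.
Local Open Scope complex_scope.

Definition mobius (A : 'M[R]_2) (z : R[i]) : R[i] :=
  let w := if 0 < \det A then z else z^* in
  ((A 0 0)%:C * w + (A 0 1)%:C) / ((A 1 0)%:C * w + (A 1 1)%:C).

Definition fixed_points (x : PSp_pm (omega2 R)) : set R[i] :=
  [set z | 0 < complex.Im z /\ mobius (val (PSp_repr x)) z = z].

(* Geodesics: intersections of the half-plane with the circles and lines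
   orthogonal to the real axis. *)
Definition geodesic (l : set R[i]) : Prop :=
  l !=set0 /\ exists u v w : R, (u, v, w) <> (0, 0, 0) /\
    l = [set z | 0 < complex.Im z /\
      u * (complex.Re z ^+ 2 + complex.Im z ^+ 2) + v * complex.Re z + w = 0].

(* x is the reflection in the geodesic through P and Q: the isometry whose fixed
   points are exactly that geodesic. *)
Definition reflection_in (x : PSp_pm (omega2 R)) (P Q : R[i]) : Prop :=
  [/\ geodesic (fixed_points x), fixed_points x P & fixed_points x Q].

(* Interior angle at P of the triangle P Q S.  The map z |-> (z - P)/(z - P^* )
   is an isometry onto the Poincare disc sending P to 0, and there the geodesics
   issued from 0 are Euclidean radii. *)
Definition hyp_angle (P Q S : R[i]) : R :=
  let u := (Q - P) / (Q - P^*) in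
  let v := (S - P) / (S - P^*) in
  acos (complex.Re (u * v^* / `|u * v|)).

Definition hyp_triangle (P Q S : R[i]) : Prop :=
  [/\ 0 < complex.Im P, 0 < complex.Im Q, 0 < complex.Im S
    & forall l, geodesic l -> ~ [/\ l P, l Q & l S]].

Definition geometric_rep (k1 k2 k3 : nat)
    (rho : HomSpace (triangle_group k1 k2 k3) (omega2 R)) : Prop :=
  exists Pab Pbc Pac : R[i],
    [/\ hyp_triangle Pab Pbc Pac,
        [/\ hyp_angle Pab Pac Pbc = pi / k1%:R,
            hyp_angle Pbc Pab Pac = pi / k2%:R
          & hyp_angle Pac Pab Pbc = pi / k3%:R],
        reflection_in (rho (tri_a k1 k2 k3)) Pab Pac,
        reflection_in (rho (tri_b k1 k2 k3)) Pab Pbc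
      & reflection_in (rho (tri_c k1 k2 k3)) Pbc Pac].

End HyperbolicPlane.

(* Main.v *)
Require Import Defs.
From HB Require Import structures.
From mathcomp Require Import all_boot all_order all_algebra.
From mathcomp Require Import all_classical all_reals all_analysis.
From mathcomp.real_closed Require Import complex mxtens.
From mathcomp Require Import ring lra.
Import Order.TTheory GRing.Theory Num.Theory.
Import numFieldNormedType.Exports.
Local Open Scope classical_set_scope.
Local Open Scope ring_scope.

Set Implicit Arguments.
Unset Strict Implicit.
Unset Printing Implicit Defensive.

(** The group [Gamma] is generated by three involutions, and a deformation of
    the diagonal representation is rigid because it stays a representation of
    the algebra of 2 x 2 matrices.

    Let [A_0, A_1, A_2] be the three reflections as matrices of trace 0 and
    determinant -1. They form a basis of the traceless 2 x 2 matrices, because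
    the three sides of a triangle have no common point ([geometric_spin]). On
    traceless matrices, [X Y + Y X] is a scalar, so the [A_i] satisfy Clifford
    relations whose form is minus the determinant. Let [rho] be a representation
    whose generators are lifted to matrices [A'_i] close to the images of the
    [A_i]. The products [A'_i A'_j] have finite order, and nearby matrices of
    the same finite order are conjugate ([near_conj_finite_order]). Hence the
    anticommutators do not move, and the [A'_i] satisfy the same Clifford
    relations. The Clifford algebra of three generators is a sum of two copies
    of the 2 x 2 matrices, distinguished by a volume element of square 1, which
    cannot jump either ([near_spin_family]). So the [A'_i] still come from a
    representation of the 2 x 2 matrices, that is from a [spin_pair].

    Two nearby representations of this kind are conjugate by a matrix close to
    the identity, namely an average over the group of order 8 generated by the
    pair. That matrix need not be symplectic, but it becomes so after division
    by the square root of an endomorphism close to the identity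
    ([near_spin_conj], [sqrt_near1]). Hence the conjugacy class of such a
    representation is open in the space of representations. It is closed too: a
    limit satisfies the same algebraic relations, hence has an open class that
    meets the given one ([clopen_orbit]). As the interval is connected, a path
    never leaves the class ([spin_rep_path]), and the class is an isolated point
    of the character variety ([isolated_spin_rep]).

    For the count, reflections realizing the three angles exist because the
    Gram matrix [1, - cos] has negative determinant ([hyperbolic_cos],
    [hyperbolic_mirrors]). Put on [R^2 (x) R^n] the representation twisted by a
    diagonal form with [q] negative entries. The symmetric form [- Om E F]
    has index [2 q], and a conjugation preserves it up to sign; so Sylvester's
    law of inertia ([inertia], [signed_spin_index]) separates the values
    [q <= n / 2]. *)

(** * Limits of matrices *)

Lemma near_fin_forall (I : finType) (T : Type) (F : set_system T) (FF : Filter F)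
    (P : I -> T -> Prop) :
  (forall i, \forall x \near F, P i x) -> \forall x \near F, forall i, P i x.
Proof.
move=> FP; suff H (s : seq I) : \forall x \near F, forall i, i \in s -> P i x.
  by apply: filterS (H (enum I)) => x Px i; apply: Px; rewrite mem_enum.
elim: s => [|i s IH]; first exact: nearW.
apply: filterS2 (FP i) IH => x Pi Ps j; rewrite inE => /orP[/eqP->//|]; exact: Ps.
Qed.

Section MatrixLimits.
Variables (R : realType) (T : Type) (F : set_system T).
Context {FF : Filter F}.

Lemma cvg_mx (p q : nat) (f : T -> 'M[R]_(p, q)) (A : 'M[R]_(p, q)) :
  (forall i j, f x i j @[x --> F] --> A i j) -> f x @[x --> F] --> A.
Proof.
move=> fA; apply/cvg_ballP => e e0; rewrite near_simpl.
have H : \forall x \near F, forall ij : 'I_p * 'I_q, ball (A ij.1 ij.2) e (f x ij.1 ij.2).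
  by apply: near_fin_forall => -[i j] /=; have /cvg_ballP/(_ _ e0) := fA i j.
by apply: filterS H => x Hx; split=> // i j; exact: (Hx (i, j)).
Qed.

Lemma cvg_mx_coord (p q : nat) (f : T -> 'M[R]_(p, q)) (A : 'M[R]_(p, q)) i j :
  f x @[x --> F] --> A -> f x i j @[x --> F] --> A i j.
Proof.
move=> fA; apply: (@cvg_comp _ _ _ f (fun M : 'M[R]_(p, q) => M i j) _ _ _ fA).
exact: coord_continuous.
Qed.

Lemma cvg_mulmx (p q r : nat) (f : T -> 'M[R]_(p, q)) (g : T -> 'M[R]_(q, r))
    (A : 'M[R]_(p, q)) (B : 'M[R]_(q, r)) :
  f x @[x --> F] --> A -> g x @[x --> F] --> B ->
  f x *m g x @[x --> F] --> A *m B.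
Proof.
move=> fA gB; apply: cvg_mx => i j; rewrite mxE.
under eq_cvg do rewrite mxE.
apply: cvg_big => [|k _]; first exact: add_continuous.
by apply: cvgM; exact: cvg_mx_coord.
Qed.

Lemma cvg_trmx (p q : nat) (f : T -> 'M[R]_(p, q)) (A : 'M[R]_(p, q)) :
  f x @[x --> F] --> A -> (f x)^T @[x --> F] --> A^T.
Proof.
move=> fA; apply: cvg_mx => i j; rewrite mxE; under eq_cvg do rewrite mxE.
exact: cvg_mx_coord.
Qed.

Lemma cvg_det (p : nat) (f : T -> 'M[R]_p) (A : 'M[R]_p) :
  f x @[x --> F] --> A -> \det (f x) @[x --> F] --> \det A.
Proof.
move=> fA; rewrite /determinant; apply: cvg_big => [|s _]; first exact: add_continuous.
apply: cvgM; first exact: cvg_cst.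
by apply: cvg_big => [|i _]; [exact: mul_continuous|exact: cvg_mx_coord].
Qed.

Lemma near_unitmx (p : nat) (f : T -> 'M[R]_p) (A : 'M[R]_p) :
  f x @[x --> F] --> A -> A \in unitmx -> \forall x \near F, f x \in unitmx.
Proof.
move=> /cvg_det fA; rewrite unitmxE unitfE => A0.
have /cvgr_neq0 := fA => /(_ A0); apply: filterS => x.
by rewrite unitmxE unitfE.
Qed.

(** This is how an algebraic alternative such as [X = 1 \/ X = -1] is decided by
    the limit: the factor [g x] stays invertible near the limit point. *)
Lemma near_factor0 (p : nat) (f g : T -> 'M[R]_p) (B : 'M[R]_p) :
  g x @[x --> F] --> B -> B \in unitmx ->
  (\forall x \near F, f x *m g x = 0) -> \forall x \near F, f x = 0.
Proof.
move=> gB uB; apply: filterS2 (near_unitmx gB uB) => x ug fg0.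
by rewrite -[f x](mulmxK ug) fg0 mul0mx.
Qed.

Lemma cvg_expmx (p : nat) (f : T -> 'M[R]_p) (A : 'M[R]_p) k :
  f x @[x --> F] --> A -> (f x) ^+ k @[x --> F] --> A ^+ k.
Proof.
move=> fA; elim: k => [|k IH]; first by rewrite expr0; exact: cvg_cst.
rewrite exprS; under eq_cvg do rewrite exprS.
exact: cvg_mulmx.
Qed.

End MatrixLimits.

Section FiniteOrder.
Variables (R : realType) (T : Type) (F : set_system T) (m : nat).
Context {FF : Filter F}.

(** The average [P] of [X ^ j X0 ^ (N - j)] over [j < N] intertwines [X] and [X0],
    and it tends to a nonzero multiple of the identity when [X] tends to [X0]. *)
Lemma near_conj_finite_order (N : nat) (X : T -> 'M[R]_m) (X0 : 'M[R]_m) :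
  (0 < N)%N -> X0 ^+ N = 1%:M -> (forall x, X x ^+ N = 1%:M) ->
  X x @[x --> F] --> X0 ->
  \forall x \near F, exists2 P, P \in unitmx & X x *m P = P *m X0.
Proof.
move=> N0 X0N XN XX0.
pose P x := \sum_(j < N) X x ^+ j *m X0 ^+ (N - j).
have PP : P x @[x --> F] --> (N%:R%:M : 'M[R]_m).
  suff -> : (N%:R%:M : 'M[R]_m) = \sum_(j < N) X0 ^+ j *m X0 ^+ (N - j).
    apply: cvg_big => [|j _]; first exact: add_continuous.
    by apply: cvg_mulmx; [exact: cvg_expmx | exact: cvg_cst].
  under eq_bigr => j _ do rewrite -[_ *m _]/(_ * _) -exprD subnKC ?X0N 1?ltnW //.
  by rewrite sumr_const card_ord -scalemx1 scaler_nat.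
apply: filterS (near_unitmx PP _) => [x uP|]; last first.
  by rewrite unitmxE det_scalar unitrX // unitfE pnatr_eq0 -lt0n.
exists (P x) => //; rewrite /P mulmx_sumr mulmx_suml.
case: N N0 X0N XN @P PP uP => // N _ X0N XN P PP uP.
(* The two sums differ by a cyclic shift; the terms that wrap around agree
   because X and X0 both have order dividing N. *)
rewrite big_ord_recr big_ord_recl /= addrC; congr (_ + _).
  rewrite mulmxA -[X x *m _]/(X x * _) -exprS XN subSnn expr1 expr0 subn0.
  by rewrite X0N !mul1mx.
apply: eq_bigr => j _; rewrite /bump /= add1n subSS mulmxA -[X x *m _]/(X x * _) -exprS.
by rewrite -mulmxA -[X0 ^+ _ *m _]/(X0 ^+ _ * _) -exprSr subSn // ltnW.
Qed.

End FiniteOrder.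

(** * Square roots close to the identity *)

Section MatrixSqrt.
Variables (R : realType) (m : nat).

HB.instance Definition _ := Complete.on 'M[R]_m.

Lemma mx_norm_coord (p q : nat) (A : 'M[R]_(p, q)) i j : `|A i j| <= `|A|.
Proof.
rewrite [in leRHS]/Num.norm /= mx_normrE.
exact: (le_bigmax _ (fun ij : 'I_p * 'I_q => `|A ij.1 ij.2|) (i, j)).
Qed.

Lemma mx_norm_le (p q : nat) (A : 'M[R]_(p, q)) (e : R) :
  0 <= e -> (forall i j, `|A i j| <= e) -> `|A| <= e.
Proof.
move=> e0 Ae; rewrite [leLHS]/Num.norm /= mx_normrE.
by apply: bigmax_le => // -[i j] _; exact: Ae.
Qed.

Lemma mulmx_norm (A B : 'M[R]_m) : `|A *m B| <= m.+1%:R * `|A| * `|B|.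
Proof.
apply: mx_norm_le => [|i j]; first by rewrite !mulr_ge0.
rewrite mxE (le_trans (ler_norm_sum _ _ _)) //.
have -> : m.+1%:R * `|A| * `|B| = \sum_(k < m.+1) `|A| * `|B|.
  by rewrite sumr_const card_ord -mulrA mulr_natl.
rewrite big_ord_recl ler_wpDl ?mulr_ge0 //.
by apply: ler_sum => k _; rewrite normrM ler_pM // mx_norm_coord.
Qed.

(** The square root [1 - Z] of [1 - Y] is found by iterating the contraction
    [Z |-> (Y + Z ^ 2) / 2], which never leaves a set [U] stable under that
    map: this is how the root inherits the symmetries of [Y]. *)
Lemma sqrt_near1 (U : set 'M[R]_m) (Y : 'M[R]_m) :
  closed U -> U 0 -> (forall Z, U Z -> U (2^-1 *: (Y + Z *m Z))) ->
  `|Y| <= (2 * m.+1%:R)^-1 ->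
  exists2 Z, U Z & (1%:M - Z) *m (1%:M - Z) = 1%:M - Y.
Proof.
move=> clU U0 UY Yr; set r := (2 * m.+1%:R)^-1 in Yr.
have c0 : 0 < m.+1%:R :> R by [].
have r0 : 0 < r by rewrite invr_gt0 mulr_gt0.
have cr : m.+1%:R * r = 2^-1 by rewrite /r; field; rewrite gt_eqF.
pose V := U `&` [set Z | `|Z| <= r].
pose f (Z : 'M[R]_m) : 'M[R]_m := 2^-1 *: (Y + Z *m Z).
have fV : {homo f : Z / V Z >-> V Z}.
  move=> Z [UZ /= Zr]; split; first exact: UY.
  rewrite /= /f normrZ ger0_norm ?invr_ge0 // mulrC ler_pdivrMr //.
  have ZZ : `|Z *m Z| <= r.
    apply: le_trans (mulmx_norm _ _) _.
    apply: (@le_trans _ _ (m.+1%:R * r * r)); last by rewrite cr; lra.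
    by apply: ler_pM => //; rewrite ler_pM2l.
  by apply: le_trans (ler_normD _ _) _; rewrite mulrDr mulr1; exact: lerD.
(* Z^2 - Z'^2 = Z (Z - Z') + (Z - Z') Z' and both factors are at most r in
   norm, where (m + 1) r = 1 / 2. *)
pose fV' : {fun V >-> V} := HB.pack f (isFun.Build _ _ _ _ f fV).
have ctr : is_contraction fV'.
  exists (2^-1)%:nng; split; first by rewrite /=; lra.
  move=> [Z Z'] /= [[_ /= Zr] [_ /= Z'r]].
  have -> : f Z - f Z' = 2^-1 *: (Z *m (Z - Z') + (Z - Z') *m Z').
    rewrite /f -scalerBr; congr (_ *: _).
    by rewrite mulmxBr mulmxBl addrA subrK opprD addrACA subrr add0r.
  rewrite normrZ ger0_norm ?invr_ge0 // ler_pM2l ?invr_gt0 //.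
  apply: le_trans (ler_normD _ _) _.
  have := mulmx_norm Z (Z - Z'); have := mulmx_norm (Z - Z') Z'.
  move: (normr_ge0 (Z - Z')); set d := `|Z - Z'| => d0 h1 h2.
  have h3 : m.+1%:R * `|Z| * d <= 2^-1 * d.
    by rewrite -cr ler_wpM2r // ler_pM2l.
  have h4 : m.+1%:R * d * `|Z'| <= 2^-1 * d.
    by rewrite -cr mulrAC ler_wpM2r // ler_pM2l.
  lra.
have clV : closed V.
  apply: closedI => //; apply: (@preimage_closed _ _ (fun Z : 'M[R]_m => `|Z|) [set x | x <= r]).
    by move=> Z _; exact: norm_continuous.
  exact: closed_le.
have [|Z [UZ _] ZE] := banach_fixed_point ctr clV.
  by exists 0; split => //=; rewrite normr0 ltW.
exists Z => //; have {}ZE : Z = f Z by [].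
have Z2 : Z *m Z = Z + Z - Y.
  move: ZE; rewrite /f; move: (Z *m Z) => W ZE; apply/matrixP => i j.
  have := congr1 (fun M : 'M[R]_m => M i j) ZE; rewrite !mxE => zE; lra.
rewrite mulmxBl !mulmxBr !mul1mx mulmx1 Z2.
by apply/matrixP => i j; rewrite !mxE; ring.
Qed.

End MatrixSqrt.

(** * Spin pairs and their rigidity *)

(** [P] is the sum of [g' g^-1] over [g = 1], [E], [F] and [E F], which represent
    the group generated by the pair modulo its center [1, -1]. *)
Lemma intertwiner (S : pzRingType) (E F E' F' : S) :
  E * E = 1 -> F * F = 1 -> E * F = - (F * E) ->
  E' * E' = 1 -> F' * F' = 1 -> E' * F' = - (F' * E') ->
  let P := 1 + E' * E + F' * F + E' * F' * F * E in E' * P = P * E /\ F' * P = P * F.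
Proof.
move=> EE FF EF EE' FF' EF' P.
have FE' : F' * E' = - (E' * F') by rewrite EF' opprK.
have FEF : F * E * F = - E by rewrite -mulrA EF mulrN mulrA FF mul1r.
have FEF' : F' * E' * F' = - E' by rewrite FE' mulNr -mulrA FF' mulr1.
split; rewrite /P !mulrDr !mulrDl mulr1 mul1r !mulrA.
  by rewrite EE' !mul1r -!(mulrA _ E E) EE !mulr1 (addrC E') -!addrA (addrC (F' * F * E)).
rewrite FF' FEF' mul1r -(mulrA F' F F) FF mulr1 -(mulrA (E' * F') F E) -(mulrA (E' * F') (F * E)) FEF.
rewrite !mulNr !mulrN FE' !mulNr -!(mulrA E' _ F) EF -(mulrA E' F E) mulrN.
by rewrite -addrA addrC addrA.
Qed.

Lemma closed_eqmx (R : realType) (p q : nat) (T : topologicalType) (f g : T -> 'M[R]_(p, q)) :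
  continuous f -> continuous g -> closed [set x | f x = g x].
Proof.
move=> fc gc; have -> : [set x | f x = g x] = (fun x => f x - g x) @^-1` [set 0].
  by apply/seteqP; split=> x /=; [move=> ->; rewrite subrr | move/eqP; rewrite subr_eq0 => /eqP].
apply: preimage_closed; first by move=> x _; apply: cvgB; [exact: fc | exact: gc].
by apply: accessible_closed_set1; apply: hausdorff_accessible; exact: norm_hausdorff.
Qed.

Section SpinPair.
Variables (R : realType) (m : nat) (Om : 'M[R]_m).

(** Two anticommuting anti-symplectic involutions: the images of
    [diag(1, -1)] and of [[0, 1], [1, 0]] under a representation of the algebra
    of 2 x 2 matrices in which traceless matrices are skew for [Om]. *)
Definition spin_pair (E F : 'M[R]_m) : Prop :=
  [/\ E *m E = 1%:M, F *m F = 1%:M, E *m F = - (F *m E),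
      E^T *m Om = - (Om *m E) & F^T *m Om = - (Om *m F)].

Hypotheses (skewOm : Om^T = - Om) (unitOm : Om \in unitmx).

(** The intertwiner [P] of the two pairs pulls [Om] back to [Om X], where [X] is
    close to 1, self-adjoint for [Om] and commutes with [E] and [F]. A square
    root [S] of [X] with the same symmetries satisfies [S^T Om S = Om X], so that
    [P S^-1] still intertwines the pairs and is symplectic. *)
Lemma near_spin_conj (T : Type) (Fl : set_system T) (FFl : Filter Fl)
    (E F : 'M[R]_m) (E' F' : T -> 'M[R]_m) :
  spin_pair E F -> E' x @[x --> Fl] --> E -> F' x @[x --> Fl] --> F ->
  (\forall x \near Fl, spin_pair (E' x) (F' x)) ->
  \forall x \near Fl, exists h, [/\ h \in unitmx, h^T *m Om *m h = Om,
     E' x *m h = h *m E & F' x *m h = h *m F].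
Proof.
move=> [EE FF EF EO FO] E'E F'F spin'.
pose P x := 4^-1 *: (1%:M + E' x *m E + F' x *m F + E' x *m F' x *m F *m E).
have P1 : P x @[x --> Fl] --> (1%:M : 'M[R]_m).
  have -> : 1%:M = 4^-1 *: (1%:M + E *m E + F *m F + E *m F *m F *m E).
    rewrite -(mulmxA E F F) FF mulmx1 EE.
    by apply/matrixP => i j; rewrite !mxE; field.
  apply: cvgZl_tmp; apply: cvgD; first apply: cvgD; first apply: cvgD.
  - exact: cvg_cst.
  - by apply: cvg_mulmx => //; exact: cvg_cst.
  - by apply: cvg_mulmx => //; exact: cvg_cst.
  apply: cvg_mulmx; last exact: cvg_cst.
  by apply: cvg_mulmx; [exact: cvg_mulmx | exact: cvg_cst].
(* The pull-back of Om by P x, read as an endomorphism. *)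
pose X x := invmx Om *m ((P x)^T *m Om *m P x).
have X1 : X x @[x --> Fl] --> (1%:M : 'M[R]_m).
  have -> : 1%:M = invmx Om *m ((1%:M)^T *m Om *m 1%:M) by rewrite trmx1 mul1mx mulmx1 mulVmx.
  apply: cvg_mulmx; first exact: cvg_cst.
  apply: cvg_mulmx => //; apply: cvg_mulmx; last exact: cvg_cst.
  exact: cvg_trmx.
have u1 : (1%:M : 'M[R]_m) \in unitmx by exact: unitmx1.
have nX : \forall x \near Fl, `|1%:M - X x| <= (2 * m.+1%:R)^-1.
  have r0 : 0 < (2 * m.+1%:R)^-1 :> R by rewrite invr_gt0 mulr_gt0.
  move/cvgrPdist_le : X1; exact.
near=> x.
have [EE' FF' EF' EO' FO'] : spin_pair (E' x) (F' x) by near: x.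
have uP : P x \in unitmx by near: x; exact: near_unitmx P1 u1.
have uX : X x \in unitmx by near: x; exact: near_unitmx X1 u1.
have Xle : `|1%:M - X x| <= (2 * m.+1%:R)^-1 by near: x.
have [/= EP FP] := intertwiner EE FF EF EE' FF' EF'.
have {}EP : E' x *m P x = P x *m E by rewrite -scalemxAr -scalemxAl; congr (_ *: _).
have {}FP : F' x *m P x = P x *m F by rewrite -scalemxAr -scalemxAl; congr (_ *: _).
set Q := P x in uP EP FP.
have OX : Om *m X x = Q^T *m Om *m Q by rewrite /X mulKVmx.
have W_skew : (Q^T *m Om *m Q)^T = - (Q^T *m Om *m Q).
  by rewrite !trmx_mul trmxK skewOm mulNmx mulmxN mulmxA.
have XO : (X x)^T *m Om = Om *m X x.
  by apply/oppr_inj; rewrite -mulmxN -skewOm -trmx_mul OX W_skew.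
have comm (C C' : 'M[R]_m) : C^T *m Om = - (Om *m C) -> C'^T *m Om = - (Om *m C') ->
    C' *m Q = Q *m C -> X x *m C = C *m X x.
  move=> CO CO' CQ; apply: (can_inj (mulKmx unitOm)).
  have CW : Q^T *m Om *m C' *m Q = - ((C' *m Q)^T *m Om *m Q).
    by rewrite trmx_mul -!mulmxA !(mulmxA C'^T) CO' mulNmx mulmxN opprK !mulmxA.
  rewrite mulmxA OX -(mulmxA _ Q C) -CQ !mulmxA CW CQ trmx_mul -!mulmxA (mulmxA Q^T) -OX.
  by rewrite (mulmxA C^T) CO mulNmx opprK mulmxA mulKmx.
(* The symmetries that the square root has to inherit from X x. *)
pose U : set 'M[R]_m :=
  [set Z | [/\ Z *m E = E *m Z, Z *m F = F *m Z & Z^T *m Om = Om *m Z]].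
have mulc (A B : 'M[R]_m -> 'M[R]_m) : continuous A -> continuous B ->
    continuous (fun Z => A Z *m B Z).
  by move=> Ac Bc Z; exact: (cvg_mulmx (Ac Z) (Bc Z)).
have idc : continuous (fun Z : 'M[R]_m => Z) by move=> Z; exact: cvg_id.
have cstc (B : 'M[R]_m) : continuous (fun _ : 'M[R]_m => B) by exact: cst_continuous.
have trc : continuous (fun Z : 'M[R]_m => Z^T).
  by move=> Z; exact: (cvg_trmx (idc Z)).
have clU : closed U.
  have -> : U = [set Z | Z *m E = E *m Z] `&` [set Z | Z *m F = F *m Z]
      `&` [set Z | Z^T *m Om = Om *m Z].
    by apply/seteqP; split=> Z /= => [[]|[[]]].
  by apply: closedI; first apply: closedI; apply: closed_eqmx; exact: mulc.
have [|Z|Z [ZE ZF ZO] SS] := sqrt_near1 clU _ _ Xle.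
- by split; rewrite ?trmx0 ?mul0mx ?mulmx0.
- move=> [ZE ZF ZO]; split.
  + rewrite -scalemxAl -scalemxAr mulmxDl mulmxDr mulmxBl mulmxBr mul1mx mulmx1.
    by rewrite (comm _ _ EO EO' EP) -mulmxA ZE !mulmxA ZE.
  + rewrite -scalemxAl -scalemxAr mulmxDl mulmxDr mulmxBl mulmxBr mul1mx mulmx1.
    by rewrite (comm _ _ FO FO' FP) -mulmxA ZF !mulmxA ZF.
  + rewrite linearZ /= -scalemxAl -scalemxAr raddfD raddfB /= trmx1 (trmx_mul Z Z).
    have ZZ : Z^T *m Z^T *m Om = Om *m (Z *m Z) by rewrite -mulmxA ZO !mulmxA ZO.
    by rewrite mulmxDl mulmxDr ZZ mulmxBl mulmxBr mul1mx mulmx1 XO.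
set S := 1%:M - Z in SS; move: SS; rewrite opprB addrC subrK => SS.
have uS : S \in unitmx by move: uX; rewrite -SS unitmx_mul => /andP[].
have SE : S *m E = E *m S by rewrite mulmxBl mulmxBr mul1mx mulmx1 ZE.
have SF : S *m F = F *m S by rewrite mulmxBl mulmxBr mul1mx mulmx1 ZF.
have SO : S^T *m Om = Om *m S.
  by rewrite raddfB /= trmx1 mulmxBl mulmxBr mul1mx mulmx1 ZO.
have inv_comm (C : 'M[R]_m) : S *m C = C *m S -> C *m invmx S = invmx S *m C.
  by move=> SC; apply: (can_inj (mulKmx uS)); rewrite mulKVmx // mulmxA SC mulmxK.
exists (Q *m invmx S); split.
- by rewrite unitmx_mul uP unitmx_inv.
- rewrite trmx_mul trmx_inv -!mulmxA !(mulmxA Q^T) !(mulmxA (Q^T *m Om)) -OX -SS.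
  rewrite !(mulmxA Om) -SO -!mulmxA mulmxV // mulmx1 SO.
  by rewrite -SO mulmxA mulVmx ?mul1mx // unitmx_tr.
- by rewrite mulmxA EP -!mulmxA inv_comm.
- by rewrite mulmxA FP -!mulmxA inv_comm.
Unshelve. all: by end_near. Qed.

End SpinPair.

(** * Clifford families *)

Section Clifford.
Variables (R : realType) (m : nat) (Om : 'M[R]_m).
Implicit Types (X : 'I_3 -> 'M[R]_m) (M N g : 'M[R]_3).

Definition clifford g X : Prop :=
  forall i j, X i *m X j + X j *m X i = (2 * g i j)%:M.

Definition lincomb M X (i : 'I_3) : 'M[R]_m := \sum_k M i k *: X k.

Lemma lincomb1 X i : lincomb 1%:M X i = X i.
Proof.
rewrite /lincomb (bigD1 i) //= big1 ?addr0 => [|k ki]; first by rewrite mxE eqxx scale1r.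
by rewrite mxE eq_sym (negPf ki) scale0r.
Qed.

Lemma lincombM M N X i : lincomb M (lincomb N X) i = lincomb (M *m N) X i.
Proof.
rewrite /lincomb; under eq_bigr do rewrite scaler_sumr.
rewrite exchange_big /=; apply: eq_bigr => l _; rewrite mxE scaler_suml.
by apply: eq_bigr => k _; rewrite scalerA.
Qed.

Lemma eq_lincomb M X X' : X =1 X' -> lincomb M X =1 lincomb M X'.
Proof. by move=> XX' i; apply: eq_bigr => k _; rewrite XX'. Qed.

Lemma lincomb_mull M X h i : h *m lincomb M X i = lincomb M (fun k => h *m X k) i.
Proof. by rewrite /lincomb mulmx_sumr; apply: eq_bigr => k _; rewrite scalemxAr. Qed.

Lemma lincomb_mulr M X h i : lincomb M X i *m h = lincomb M (fun k => X k *m h) i.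
Proof. by rewrite /lincomb mulmx_suml; apply: eq_bigr => k _; rewrite scalemxAl. Qed.

Lemma lincomb_mul M X i j :
  lincomb M X i *m lincomb M X j = \sum_k \sum_l (M i k * M j l) *: (X k *m X l).
Proof.
rewrite lincomb_mulr; apply: eq_bigr => k _; rewrite lincomb_mull scaler_sumr.
by apply: eq_bigr => l _; rewrite scalerA.
Qed.

Lemma clifford_lincomb g M X :
  clifford g X -> clifford (M *m g *m M^T) (lincomb M X).
Proof.
move=> cX i j; rewrite !lincomb_mul [X in _ + X]exchange_big /= -big_split /=.
under eq_bigr => k _.
  rewrite -big_split /=; under eq_bigr => l _.
    rewrite [M j l * _]mulrC -scalerDr cX scale_scalar_mx; over.
  over.
under eq_bigr do rewrite -raddf_sum /=.
rewrite -raddf_sum /=; congr (_%:M); rewrite !mxE exchange_big mulr_sumr.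
apply: eq_bigr => l _; rewrite !mxE mulr_suml mulr_sumr; apply: eq_bigr => k _; ring.
Qed.

Definition skew_family X : Prop := forall i, (X i)^T *m Om = - (Om *m X i).

Lemma skew_lincomb M X : skew_family X -> skew_family (lincomb M X).
Proof.
move=> sX i; rewrite /lincomb raddf_sum mulmx_suml mulmx_sumr -sumrN.
by apply: eq_bigr => k _; rewrite /= linearZ /= -scalemxAl sX -scalemxAr scalerN.
Qed.

Lemma cvg_lincomb (T : Type) (Fl : set_system T) (FFl : Filter Fl) M
    (A : T -> 'I_3 -> 'M[R]_m) X i :
  (forall k, A x k @[x --> Fl] --> X k) -> lincomb M (A x) i @[x --> Fl] --> lincomb M X i.
Proof.
move=> AX; apply: cvg_big => [|k _]; first exact: add_continuous.
by apply: cvgZl_tmp; exact: AX.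
Qed.

Definition spin (E F : 'M[R]_m) (k : 'I_3) : 'M[R]_m := [:: E; F; E *m F]`_k.

(** Minus the determinant on traceless 2 x 2 matrices, in the basis [spin]. *)
Definition eta : 'M[R]_3 := diag_mx (\row_k (if k == 2 then -1 else 1)).

Lemma ord3_ind (P : 'I_3 -> Prop) : P 0 -> P 1 -> P 2 -> forall k, P k.
Proof.
move=> P0 P1 P2 [[|[|[|k]]] // kk].
- by rewrite (_ : Ordinal kk = 0) //; apply/val_inj.
- by rewrite (_ : Ordinal kk = 1) //; apply/val_inj.
- by rewrite (_ : Ordinal kk = 2) //; apply/val_inj.
Qed.

Lemma spin_skew E F : spin_pair Om E F -> skew_family (spin E F).
Proof.
move=> [EE FF EF EO FO]; elim/ord3_ind => //=.
rewrite /spin /= trmx_mul -mulmxA EO mulmxN (mulmxA F^T) FO mulNmx opprK -mulmxA.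
by rewrite EF mulmxN opprK.
Qed.

Lemma spin_clifford E F : spin_pair Om E F -> clifford eta (spin E F).
Proof.
move=> [EE FF EF EO FO]; have FE : F *m E = - (E *m F) by rewrite EF opprK.
have s0 : (2 * 0 : R)%:M = 0 :> 'M[R]_m by rewrite mulr0 raddf0.
have s1 : (2 * 1 : R)%:M = 1%:M + 1%:M :> 'M[R]_m by rewrite mulr1 -raddfD.
elim/ord3_ind; elim/ord3_ind; rewrite /spin /eta !mxE ?mulr1n ?mulr0n ?s0 ?s1 /= ?EE ?FF //.
- by rewrite EF addNr.
- by rewrite mulmxA EE mul1mx -mulmxA FE mulmxN mulmxA EE mul1mx subrr.
- by rewrite FE addNr.
- by rewrite mulmxA FE mulNmx -mulmxA FF mulmx1 addNr.
- by rewrite mulmxA EE mul1mx -mulmxA FE mulmxN mulmxA EE mul1mx addNr.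
- by rewrite mulmxA FE mulNmx -mulmxA FF mulmx1 subrr.
have GG : E *m F *m (E *m F) = - 1%:M.
  by rewrite mulmxA -(mulmxA E F E) FE mulmxN mulmxA EE mul1mx mulNmx FF.
by rewrite GG mulrN1 raddfN /= raddfD opprD.
Qed.

(** The Clifford form of the family [lincomb M (spin E F)]; its entries are half
    the traces of the products of two 2 x 2 reflections. *)
Definition gram M := M *m eta *m M^T.

(** The Clifford relations alone allow [S 2 = S 0 S 1] or [S 2 = - S 0 S 1]: the
    volume element [S 0 S 1 S 2] has square 1, and its limit is -1. *)
Lemma near_spin_family (T : Type) (Fl : set_system T) (FFl : Filter Fl)
    (S : T -> 'I_3 -> 'M[R]_m) E F :
  spin_pair Om E F -> (forall k, S x k @[x --> Fl] --> spin E F k) ->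
  (\forall x \near Fl, clifford eta (S x)) ->
  \forall x \near Fl, S x =1 spin (S x 0) (S x 1).
Proof.
move=> spinEF SX cS.
have [EE FF EF EO FO] := spinEF.
have s0 : (2 * 0 : R)%:M = 0 :> 'M[R]_m by rewrite mulr0 raddf0.
pose z x := S x 0 *m S x 1 *m S x 2.
have zX : z x @[x --> Fl] --> (- 1%:M : 'M[R]_m).
  suff -> : - 1%:M = spin E F 0 *m spin E F 1 *m spin E F 2 :> 'M[R]_m.
    by apply: cvg_mulmx => //; exact: cvg_mulmx.
  by rewrite /spin /= mulmxA -(mulmxA E F E) -[F *m E]opprK -EF mulmxN mulmxA EE mul1mx mulNmx FF.
have key x : clifford eta (S x) ->
    [/\ S x 0 *m S x 0 = 1%:M, S x 1 *m S x 1 = 1%:M, S x 2 *m S x 2 = - 1%:M &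
    [/\ S x 1 *m S x 0 = - (S x 0 *m S x 1), S x 2 *m S x 0 = - (S x 0 *m S x 2)
      & S x 2 *m S x 1 = - (S x 1 *m S x 2)]].
  have half (A B : 'M[R]_m) : A + A = B + B -> A = B.
    move=> AB; apply/matrixP => i j.
    by have := congr1 (fun C : 'M[R]_m => C i j) AB; rewrite !mxE; lra.
  move=> c; split.
  - by apply: half; rewrite c !mxE /= mulr1 -raddfD.
  - by apply: half; rewrite c !mxE /= mulr1 -raddfD.
  - by apply: half; rewrite c !mxE /= -raddfN -raddfD mulrN1 opprD.
  split; apply/eqP; rewrite -addr_eq0 c !mxE /= s0 //.
have zz : \forall x \near Fl, (z x + 1%:M) *m (z x - 1%:M) = 0.
  apply: filterS cS => x /key [S00 S11 S22 [S10 S20 S21]].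
  have zz1 : z x *m z x = 1%:M.
    rewrite /z -[_ *m S x 2 *m _]mulmxA !(mulmxA (S x 2)) S20 mulNmx -(mulmxA (S x 0) (S x 2)) S21.
    rewrite mulmxN opprK -!mulmxA S22 !mulmxN mulmx1 !mulmxA -(mulmxA (S x 0)) S10.
    by rewrite mulmxN mulNmx opprK mulmxA S00 mul1mx S11.
  by rewrite mulmxBr mulmxDl !mulmx1 mul1mx zz1 (addrC 1%:M) subrr.
have z2 : z x - 1%:M @[x --> Fl] --> (- 1%:M - 1%:M : 'M[R]_m).
  by apply: cvgB; [exact: zX | exact: cvg_cst].
have u2 : (- 1%:M - 1%:M : 'M[R]_m) \in unitmx.
  have -> : - 1%:M - 1%:M = (- 2)%:M :> 'M[R]_m by rewrite -[2]/(1 + 1) raddfN raddfD opprD.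
  by rewrite unitmxE det_scalar unitrX // unitfE oppr_eq0 pnatr_eq0.
apply: filterS2 cS (near_factor0 z2 u2 zz) => x /key [_ _ S22 _] /eqP.
rewrite addr_eq0 /z => /eqP S012; elim/ord3_ind => //=.
have := congr1 (fun C => C *m S x 2) S012.
by rewrite /= -mulmxA S22 mulmxN mulmx1 mulNmx mul1mx => /oppr_inj <-.
Qed.

(** The finite orders fix the anticommutators of the [A x i], so these form a
    Clifford family for the Gram matrix of [M]; in the coordinates given by
    [invmx M] it is a spin family close to [spin E F]. *)
Lemma near_reflections_conj (T : Type) (Fl : set_system T) (FFl : Filter Fl)
    (A : T -> 'I_3 -> 'M[R]_m) M E F :
  (0 < m)%N -> Om^T = - Om -> Om \in unitmx ->
  M \in unitmx -> (forall i, gram M i i = 1) -> spin_pair Om E F ->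
  (forall i, A x i @[x --> Fl] --> lincomb M (spin E F) i) ->
  (forall x i, (A x i)^T *m Om *m A x i = Om \/ (A x i)^T *m Om *m A x i = - Om) ->
  (forall i j, exists2 N, (0 < N)%N &
     (lincomb M (spin E F) i *m lincomb M (spin E F) j) ^+ N = 1%:M /\
     forall x, (A x i *m A x j) ^+ N = 1%:M) ->
  \forall x \near Fl, exists h, [/\ h \in unitmx, h^T *m Om *m h = Om &
    forall i, A x i *m h = h *m lincomb M (spin E F) i].
Proof.
move=> m0 skewOm uOm uM gM1 spinEF AC AO AN; set C := lincomb M (spin E F) in AC AN *.
have cC : clifford (gram M) C by apply: clifford_lincomb; exact: spin_clifford spinEF.
have sC : skew_family C by apply: skew_lincomb; exact: spin_skew.
have half (X Y : 'M[R]_m) : X + X = Y + Y -> X = Y.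
  move=> XY; apply/matrixP => i j.
  by have := congr1 (fun Z : 'M[R]_m => Z i j) XY; rewrite !mxE; lra.
have CC i : C i *m C i = 1%:M by apply: half; rewrite cC gM1 mulr1 -[2]/(1 + 1) raddfD.
have conjAC : \forall x \near Fl, forall ij : 'I_3 * 'I_3, exists2 P, P \in unitmx &
    A x ij.1 *m A x ij.2 *m P = P *m (C ij.1 *m C ij.2).
  apply: near_fin_forall => -[i j] /=; have [N N0 [CN AxN]] := AN i j.
  by apply: (near_conj_finite_order N0 CN AxN); apply: cvg_mulmx; exact: AC.
have AA : \forall x \near Fl, forall i, A x i *m A x i = 1%:M.
  apply: filterS conjAC => x H i; have [P uP /=] := H (i, i).
  by rewrite CC mulmx1 => AP; rewrite -[LHS](mulmxK uP) AP mulmxV.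
have cA : \forall x \near Fl, clifford (gram M) (A x).
  apply: filterS2 AA conjAC => x AA H i j; have [P uP /= HP] := H (i, j).
  have HP' : A x j *m A x i *m P = P *m (C j *m C i).
    have PE : P = A x i *m A x j *m P *m (C j *m C i).
      by rewrite HP -!mulmxA (mulmxA (C j)) CC mul1mx CC mulmx1.
    by rewrite {1}PE !mulmxA -(mulmxA (A x j) (A x i) (A x i)) AA mulmx1 AA mul1mx.
  rewrite -[LHS](mulmxK uP) mulmxDl HP HP' -mulmxDr cC mul_mx_scalar -scalemxAl.
  by rewrite mulmxV // scalemx1.
(* Each A x i reverses the sign of Om, as its limit does. *)
have sA : \forall x \near Fl, skew_family (A x).
  have sA' : \forall x \near Fl, forall i, (A x i)^T *m Om *m A x i + Om = 0.
    apply: near_fin_forall => i.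
    have lim : (A x i)^T *m Om *m A x i - Om @[x --> Fl] --> - Om - Om.
      apply: cvgB; last exact: cvg_cst.
      have -> : - Om = (C i)^T *m Om *m C i by rewrite sC mulNmx -mulmxA CC mulmx1.
      apply: cvg_mulmx (AC i); apply: cvg_mulmx; last exact: cvg_cst.
      exact: cvg_trmx (AC i).
    have uOO : - Om - Om \in unitmx.
      have -> : - Om - Om = (- 2)%:M *m Om.
        by rewrite mul_scalar_mx scaleNr -[2]/(1 + 1) scalerDl scale1r opprD.
      by rewrite unitmx_mul uOm andbT unitmxE det_scalar unitrX // unitfE oppr_eq0 pnatr_eq0.
    apply: filterS (near_unitmx lim uOO) => x; case: (AO x i) => ->; last by rewrite addNr.
    rewrite subrr => /mulmxV; rewrite mul0mx => /matrixP/(_ (Ordinal m0) (Ordinal m0)).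
    by rewrite !mxE eqxx => /eqP; rewrite eq_sym oner_eq0.
  apply: filterS2 sA' AA => x H AA i; rewrite -[LHS]mulmx1 -(AA i) mulmxA.
  by have /eqP := H i; rewrite addr_eq0 => /eqP ->; rewrite mulNmx.
pose S x := lincomb (invmx M) (A x).
have SS k : S x k @[x --> Fl] --> spin E F k.
  have -> : spin E F k = lincomb (invmx M) C k by rewrite lincombM mulVmx // lincomb1.
  exact: cvg_lincomb.
have cS : \forall x \near Fl, clifford eta (S x).
  apply: filterS cA => x /(clifford_lincomb (invmx M)).
  by rewrite /gram trmx_inv !mulmxA mulVmx // mul1mx mulmxK // unitmx_tr.
have vS := near_spin_family FFl spinEF SS cS.
have spinS : \forall x \near Fl, spin_pair Om (S x 0) (S x 1).
  apply: filterS3 cS sA (vS) => x c /(skew_lincomb (invmx M)) s _; split; rewrite ?s //.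
  - by apply: half; rewrite c !mxE /= mulr1 -[2]/(1 + 1) raddfD.
  - by apply: half; rewrite c !mxE /= mulr1 -[2]/(1 + 1) raddfD.
  - by apply/eqP; rewrite -addr_eq0 c !mxE /= mulr0 raddf0.
have := near_spin_conj skewOm uOm FFl spinEF (SS 0) (SS 1) spinS.
apply: filterS2 vS => x vx [h [uh hO hE hF]]; exists h; split=> // i.
have -> : A x i = lincomb M (S x) i by rewrite lincombM mulmxV // lincomb1.
rewrite (eq_lincomb M vx) lincomb_mull lincomb_mulr; apply: eq_lincomb => k.
elim/ord3_ind: k => //=; rewrite /spin /=.
by rewrite -mulmxA hF !mulmxA hE.
Qed.

End Clifford.

(** * Presented groups and the triangle group *)

Section Presentations.
Variables (X : choiceType) (rels : set (seq (X * bool))) (G : groupType).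
Local Open Scope group_scope.

Lemma pres_class_cons (l : X * bool) w :
  pres_class rels (l :: w) = pres_class rels [:: l] * pres_class rels w.
Proof. by rewrite -[l :: w]/([:: l] ++ w) pres_classM. Qed.

Lemma pres_class_inv (x : X) :
  pres_class rels [:: (x, true)] = (pres_class rels [:: (x, false)])^-1.
Proof.
apply: (mulIg (pres_class rels [:: (x, false)])); rewrite mulVg -[LHS]pres_classM.
by apply/pres_classP; exact: (pres_cancel _ x true).
Qed.

Lemma pres_hom1 (f : presented rels -> G) :
  (forall x y, f (x * y) = f x * f y) -> f 1 = 1.
Proof. by move=> fM; apply: (mulIg (f 1)); rewrite -fM !mul1g. Qed.

Lemma pres_hom_ext (f g : presented rels -> G) :
  (forall x y, f (x * y) = f x * f y) -> (forall x y, g (x * y) = g x * g y) ->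
  (forall x, f (pres_class rels [:: (x, false)]) = g (pres_class rels [:: (x, false)])) ->
  f =1 g.
Proof.
move=> fM gM fg y; rewrite -[y]pres_reprK; elim: (pres_repr y) => [|[x e] w IH].
  by rewrite (_ : pres_class rels [::] = 1) // !pres_hom1.
rewrite pres_class_cons fM gM IH; congr (_ * _); case: e; last exact: fg.
rewrite pres_class_inv; apply: (mulIg (f (pres_class rels [:: (x, false)]))).
by rewrite -fM fg -gM mulVg !pres_hom1.
Qed.

Variable s : X -> G.

Definition eval_letter (l : X * bool) : G := if l.2 then (s l.1)^-1 else s l.1.
Definition eval_word (w : seq (X * bool)) : G := foldr (fun l g => eval_letter l * g) 1 w.

Lemma eval_word_cat u v : eval_word (u ++ v) = eval_word u * eval_word v.
Proof. by elim: u => [|l u IH] /=; rewrite ?mul1g // IH mulgA. Qed.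

Hypothesis s_rels : forall r, rels r -> eval_word r = 1.

Lemma eval_word_eq u v : pres_eq rels u v -> eval_word u = eval_word v.
Proof.
elim=> // [{}u {}v w _ -> _ -> //|u1 u2 v1 v2 _ h1 _ h2|x e].
  by rewrite !eval_word_cat h1 h2.
by case: e; rewrite /= /eval_letter /= mulg1 ?mulVg ?mulgV.
Qed.

Definition pres_lift (x : presented rels) : G := eval_word (pres_repr x).

Lemma pres_liftM x y : pres_lift (x * y) = pres_lift x * pres_lift y.
Proof. by rewrite /pres_lift -eval_word_cat; apply: eval_word_eq; exact: pres_repr_class. Qed.

Lemma pres_lift_gen x : pres_lift (pres_class rels [:: (x, false)]) = s x.
Proof. by rewrite /pres_lift (eval_word_eq (pres_repr_class _ _)) /= mulg1. Qed.

End Presentations.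

Section Triangle.
Variables (k1 k2 k3 : nat).
Local Open Scope group_scope.

Definition gen (i : 'I_3) : triangle_group k1 k2 k3 :=
  pres_class (triangle_relators k1 k2 k3) [:: (i, false)].

Lemma pres_class_word_pow k w :
  pres_class (triangle_relators k1 k2 k3) (word_pow k w) =
  pres_class (triangle_relators k1 k2 k3) w ^+ k.
Proof.
elim: k => [|k IH]; first by [].
by rewrite /word_pow /= pres_classM -/(word_pow k w) IH expgS.
Qed.

Lemma gen_order : (0 < k1)%N -> (0 < k2)%N -> (0 < k3)%N ->
  forall i j : 'I_3, exists2 N, (0 < N)%N & (gen i * gen j) ^+ N = 1.
Proof.
move=> k10 k20 k30.
have rel1 (w : seq ('I_3 * bool)) : triangle_relators k1 k2 k3 w ->
    pres_class (triangle_relators k1 k2 k3) w = 1.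
  by move=> rw; apply/pres_classP; exact: pres_relator.
have gen2 i : gen i ^+ 2 = 1.
  rewrite -pres_class_word_pow; apply: rel1; rewrite /triangle_relators /= !inE.
  by elim/ord3_ind: i; rewrite eqxx ?orbT.
have genM (i j : 'I_3) : gen i * gen j =
    pres_class (triangle_relators k1 k2 k3) [:: (i, false); (j, false)].
  by rewrite [RHS]pres_class_cons.
have gab : (gen 0%R * gen 1%R) ^+ k1 = 1.
  rewrite genM -pres_class_word_pow; apply: (rel1 (word_pow k1 [:: letter_a; letter_b])).
  by rewrite /triangle_relators /= !inE eqxx ?orbT.
have gbc : (gen 1%R * gen 2%R) ^+ k2 = 1.
  rewrite genM -pres_class_word_pow; apply: (rel1 (word_pow k2 [:: letter_b; letter_c])).
  by rewrite /triangle_relators /= !inE eqxx ?orbT.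
have gac : (gen 0%R * gen 2%R) ^+ k3 = 1.
  rewrite genM -pres_class_word_pow; apply: (rel1 (word_pow k3 [:: letter_a; letter_c])).
  by rewrite /triangle_relators /= !inE eqxx ?orbT.
have genV i : (gen i)^-1 = gen i.
  by apply: (mulgI (gen i)); rewrite mulgV -expg2 gen2.
have swap i j N : (gen i * gen j) ^+ N = 1 -> (gen j * gen i) ^+ N = 1.
  by move=> h; rewrite -(genV i) -(genV j) -invgM expVgn h invg1.
elim/ord3_ind; elim/ord3_ind; try (by exists 2 => //; rewrite -expg2 gen2 expg1n).
- by exists k1.
- by exists k3.
- by exists k1 => //; exact: swap.
- by exists k2.
- by exists k3 => //; exact: swap.
- by exists k2 => //; exact: swap.
Qed.

End Triangle.

(** * Lifting projective representations to matrices *)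

Section Lifts.
Variables (R : realType) (m : nat) (Om : 'M[R]_m).

Lemma PSp_class_eq (A B : Sp_pm Om) :
  PSp_class A = PSp_class B <-> val A = val B \/ val A = - val B.
Proof.
split=> [/PSp_classP/orP[] /eqP|[] AB]; [by left|by right| |];
  by apply/PSp_classP; rewrite /pm_rel AB eqxx ?orbT.
Qed.

Lemma PSp_class1P (A : Sp_pm Om) :
  PSp_class A = 1%g <-> val A = 1%:M \/ val A = - 1%:M.
Proof. exact: (PSp_class_eq A (Sp_one Om)). Qed.

Lemma PSp_class_mulg (A B : Sp_pm Om) : PSp_class (A * B)%g = (PSp_class A * PSp_class B)%g.
Proof. exact: PSp_classM. Qed.

Lemma PSp_classX (A : Sp_pm Om) k : PSp_class (A ^+ k)%g = (PSp_class A ^+ k)%g.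
Proof. by elim: k => // k IH; rewrite !expgS PSp_class_mulg IH. Qed.

Lemma Sp_valX (A : Sp_pm Om) k : val (A ^+ k)%g = (val A) ^+ k.
Proof. by elim: k => // k IH; rewrite expgS exprS -IH. Qed.

Lemma PSp_order (A : Sp_pm Om) N : (PSp_class A ^+ N)%g = 1%g -> (val A) ^+ (N * 2) = 1%:M.
Proof.
rewrite -PSp_classX => /PSp_class1P; rewrite Sp_valX exprM expr2 => -[] ->.
  exact: mulmx1.
by rewrite mulrNN; exact: mulmx1.
Qed.

(** A section of the projection, continuous at the class of [A1]: among the two
    preimages take the one closest to [A1]. *)
Lemma PSp_near_lift (A1 : Sp_pm Om) : exists L : PSp_pm Om -> Sp_pm Om,
  (forall x, PSp_class (L x) = x) /\ val (L x) @[x --> PSp_class A1] --> val A1.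
Proof.
have Nsub (A : Sp_pm Om) : Sp_set Om (- val A).
  have [uA AE] := Sp_pmP A; split; first by rewrite -scaleN1r unitmxZ ?unitrN1.
  have -> : (- val A)^T = - (val A)^T by apply/matrixP => i j; rewrite !mxE.
  by rewrite !mulNmx mulmxN opprK.
pose L x := let r := PSp_repr x in
  if `|val A1 - val r| <= `|val A1 + val r| then r else mkSp (Nsub r).
exists L; split=> [x|].
  rewrite /L; case: ifP => _; first exact: PSp_reprK.
  by rewrite -[RHS]PSp_reprK; apply/PSp_class_eq; right.
have FF : Filter (nbhs (PSp_class A1)) by exact: nbhs_filter.
apply/cvgrPdist_lt => e e0.
(* O is open because its preimage is the union of a ball and its opposite. *)
pose O : set (PSp_pm Om) := [set x | exists2 A, x = PSp_class A & `|val A1 - val A| < e].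
have Ople x : O x -> `|val A1 - val (L x)| < e.
  move=> [A xA Ae]; have : PSp_class (PSp_repr x) = PSp_class A by rewrite PSp_reprK.
  rewrite /L => /PSp_class_eq[] rA; case: ifP => //=; rewrite rA ?opprK //.
    by move=> /negbT; rewrite -ltNge => /lt_trans; apply.
  by move=> /le_lt_trans; apply.
suff OO : open O.
  have O1 : O (PSp_class A1) by exists A1 => //; rewrite subrr normr0.
  by have := open_nbhs_nbhs (conj OO O1); apply: filterS.
pose B : set 'M[R]_m := [set M | `|val A1 - M| < e] `|` [set M | `|val A1 + M| < e].
have oB : open B.
  have op (f : 'M[R]_m -> 'M[R]_m) : continuous f -> open [set M | `|f M| < e].
    move=> fc; apply: (@open_comp _ _ (fun M => `|f M|) [set x | x < e]).
      by move=> M _; apply: continuous_comp; [exact: fc | exact: norm_continuous].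
    exact: open_lt.
  have idc : continuous (fun M : 'M[R]_m => M) by move=> M; exact: cvg_id.
  have cc : continuous (fun _ : 'M[R]_m => val A1) by exact: cst_continuous.
  apply: openU; apply: op => M; first exact: cvgB (cc M) (idc M).
  exact: cvgD (cc M) (idc M).
rewrite /open /= /quotient_open -[X in open X]/(@PSp_class R m Om @^-1` O).
have -> : @PSp_class R m Om @^-1` O = val @^-1` B.
  apply/seteqP; split=> A /=.
    move=> [C AC Ce]; have /PSp_class_eq[] : PSp_class A = PSp_class C by [].
      by move=> ->; left.
    by move=> ->; right.
  move=> [|] /= Ae; first by exists A.
  by exists (mkSp (Nsub A)); [apply/PSp_class_eq; right; rewrite opprK | rewrite /= opprK].
by exists B.
Qed.

Variables (k1 k2 k3 : nat).
Local Notation Hom := (HomSpace (triangle_group k1 k2 k3) Om).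

Lemma HomSpaceM (rho : Hom) x y : rho (x * y)%g = (rho x * rho y)%g.
Proof. by have /set_mem := valP rho; apply. Qed.

Lemma HomSpace_eval_cvg (rho : Hom) g : (sigma : Hom) g @[sigma --> rho] --> rho g.
Proof.
have c1 : val @ nbhs rho --> (val rho : {ptws triangle_group k1 k2 k3 -> PSp_pm Om}).
  exact: (@initial_continuous _ _ _ rho).
have c2 : (fun f : {ptws triangle_group k1 k2 k3 -> PSp_pm Om} => f g) @ nbhs (val rho) --> val rho g.
  exact: (@proj_continuous _ (fun=> PSp_pm Om) g (val rho)).
exact: cvg_comp c1 c2.
Qed.

Lemma HomSpace_near_lifts (rho : Hom) (A1 : 'I_3 -> Sp_pm Om) :
  (forall i, PSp_class (A1 i) = rho (gen k1 k2 k3 i)) ->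
  exists A : Hom -> 'I_3 -> Sp_pm Om,
    (forall sigma i, PSp_class (A sigma i) = sigma (gen k1 k2 k3 i)) /\
    forall i, val (A sigma i) @[sigma --> rho] --> val (A1 i).
Proof.
move=> A1rho; have /choice[L LP] : forall i, exists L : PSp_pm Om -> Sp_pm Om,
    (forall x, PSp_class (L x) = x) /\ val (L x) @[x --> PSp_class (A1 i)] --> val (A1 i).
  by move=> i; exact: PSp_near_lift.
exists (fun sigma i => L i (sigma (gen k1 k2 k3 i))); split=> [sigma i|i].
  by have [-> _] := LP i.
have [_ Lc] := LP i; rewrite A1rho in Lc.
exact: cvg_comp (@HomSpace_eval_cvg rho (gen k1 k2 k3 i)) Lc.
Qed.

Lemma conjugate_rep_gen (rho sigma : Hom) (g : PSp_pm Om) :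
  (forall i, sigma (gen k1 k2 k3 i) = (g * rho (gen k1 k2 k3 i) * g^-1)%g) ->
  conjugate_rep rho sigma.
Proof.
move=> H; exists g; apply: pres_hom_ext => [x y|x y|i] /=; last exact: H.
  exact: HomSpaceM.
by rewrite HomSpaceM !mulgA; congr (_ * _ * _)%g; rewrite -!mulgA mulVg mulg1.
Qed.

Lemma HomSpace_order : (0 < k1)%N -> (0 < k2)%N -> (0 < k3)%N ->
  forall i j, exists2 N, (0 < N)%N & forall (rho : Hom) (L : 'I_3 -> Sp_pm Om),
    (forall i, PSp_class (L i) = rho (gen k1 k2 k3 i)) ->
    (val (L i) *m val (L j)) ^+ N = 1%:M.
Proof.
move=> k10 k20 k30 i j; have [N N0 ijN] := gen_order k10 k20 k30 i j.
exists (N * 2)%N => [|rho L Lrho]; first by rewrite muln_gt0 N0.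
apply: (@PSp_order (L i * L j)%g); rewrite PSp_class_mulg !Lrho -HomSpaceM.
have rhoX g k : (rho g ^+ k)%g = rho (g ^+ k)%g.
  elim: k => [|k IH]; last by rewrite !expgS IH -HomSpaceM.
  by rewrite (pres_hom1 (@HomSpaceM rho)).
by rewrite rhoX ijN (pres_hom1 (@HomSpaceM rho)).
Qed.

End Lifts.

(** * Representations of spin type *)

Section SpinRepresentations.
Variables (R : realType) (m k1 k2 k3 : nat) (Om : 'M[R]_m) (M : 'M[R]_3).
Hypotheses (m0 : (0 < m)%N) (skewOm : Om^T = - Om) (unitOm : Om \in unitmx).
Hypotheses (k10 : (0 < k1)%N) (k20 : (0 < k2)%N) (k30 : (0 < k3)%N).
Hypotheses (unitM : M \in unitmx) (gramM : forall i, gram M i i = 1).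
Local Notation Hom := (HomSpace (triangle_group k1 k2 k3) Om).
Local Notation gen := (gen k1 k2 k3).

(** The three generators are reflections with fixed coordinates [M], in some
    representation of the algebra of 2 x 2 matrices compatible with [Om]. *)
Definition spin_rep (rho : Hom) : Prop :=
  exists E F, spin_pair Om E F /\ exists L : 'I_3 -> Sp_pm Om,
    (forall i, val (L i) = lincomb M (spin E F) i) /\
    forall i, PSp_class (L i) = rho (gen i).

Lemma spin_pair_conj (h E F : 'M[R]_m) : Sp_set Om h -> spin_pair Om E F ->
  spin_pair Om (h *m E *m invmx h) (h *m F *m invmx h).
Proof.
move=> [uh hO] [EE FF EF EO FO].
have mulc (A B : 'M[R]_m) :
    h *m A *m invmx h *m (h *m B *m invmx h) = h *m (A *m B) *m invmx h.
  by rewrite !mulmxA mulmxKV.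
have skew (A : 'M[R]_m) : A^T *m Om = - (Om *m A) ->
    (h *m A *m invmx h)^T *m Om = - (Om *m (h *m A *m invmx h)).
  have [e [ee hO']] : exists e : R, e * e = 1 /\ h^T *m Om *m h = e *: Om.
    case: hO => hO; first by exists 1; rewrite mulr1 scale1r.
    by exists (- 1); rewrite mulrNN mulr1 scaleN1r.
  have hk : h^T *m Om = e *: (Om *m invmx h) by rewrite scalemxAl -hO' mulmxK.
  have kh : e *: ((invmx h)^T *m Om) = Om *m h.
    rewrite -[Om in LHS]scale1r -ee -scalerA -hO' -scalemxAr scalerA ee scale1r.
    by rewrite !mulmxA trmx_inv mulVmx ?mul1mx // unitmx_tr.
  move=> AO; rewrite !trmx_mul -!mulmxA hk -!scalemxAr !(mulmxA A^T) AO.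
  by rewrite mulNmx mulmxN scalerN -!mulmxA (mulmxA _ Om) scalemxAl kh -!mulmxA.
split; rewrite ?mulc ?EE ?FF ?EF; [| | |exact: skew|exact: skew].
- by rewrite mulmx1 mulmxV.
- by rewrite mulmx1 mulmxV.
- by rewrite mulmxN mulNmx.
Qed.

Lemma spin_rep_conj (rho sigma : Hom) :
  spin_rep rho -> conjugate_rep rho sigma -> spin_rep sigma.
Proof.
move=> [E [F [spinEF [L [LE Lrho]]]]] [g rhog].
set h := PSp_repr g; have [uh hO] := Sp_pmP h.
exists (val h *m E *m invmx (val h)), (val h *m F *m invmx (val h)).
split; first by apply: spin_pair_conj => //; exact: Sp_pmP.
exists (fun i => h * L i * h^-1)%g; split=> i; last first.
  rewrite rhog !PSp_class_mulg Lrho PSp_reprK; congr (_ * _)%g.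
rewrite /= LE lincomb_mull lincomb_mulr; apply: eq_lincomb => k.
elim/ord3_ind: k => //=; rewrite /spin /=.
by rewrite !mulmxA mulmxKV.
Qed.

Lemma conjugate_rep_sym (rho sigma : Hom) : conjugate_rep rho sigma -> conjugate_rep sigma rho.
Proof.
by move=> rs; apply/asboolP; rewrite -[asbool _]/(conj_rel sigma rho) conj_rel_sym; apply/asboolP.
Qed.

Lemma conjugate_rep_trans (rho sigma tau : Hom) :
  conjugate_rep rho sigma -> conjugate_rep sigma tau -> conjugate_rep rho tau.
Proof.
by move=> rs st; apply/asboolP; apply: (@conj_rel_trans _ _ _ _ sigma); exact/asboolP.
Qed.

(** Local rigidity: lift the nearby representations continuously, and apply
    [near_reflections_conj] to the lifts of the generators. *)
Lemma spin_rep_near_conj (rho : Hom) :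
  spin_rep rho -> \forall sigma \near rho, conjugate_rep rho sigma.
Proof.
move=> [E [F [spinEF [L [LE Lrho]]]]].
have [A [Asigma Acvg]] := HomSpace_near_lifts Lrho.
have AC i : val (A sigma i) @[sigma --> rho] --> lincomb M (spin E F) i.
  by rewrite -LE; exact: Acvg.
have FF : Filter (nbhs rho) by exact: nbhs_filter.
have := @near_reflections_conj R m Om Hom (nbhs rho) FF (fun s i => val (A s i)) M E F
  m0 skewOm unitOm unitM gramM spinEF AC.
have H2 (s : Hom) i : (val (A s i))^T *m Om *m val (A s i) = Om
    \/ (val (A s i))^T *m Om *m val (A s i) = - Om by case: (Sp_pmP (A s i)).
move=> /(_ H2) H.
have {}H : \forall s \near rho, exists h, [/\ h \in unitmx, h^T *m Om *m h = Om &
    forall i, val (A s i) *m h = h *m lincomb M (spin E F) i].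
  apply: H => i j; have [N N0 HN] := HomSpace_order Om k10 k20 k30 i j.
  by exists N => //; split=> [|s]; [rewrite -!LE; exact: HN Lrho | exact: HN (Asigma s)].
apply: filterS H => s [h [uh hO hA]].
have sph : Sp_set Om h by split=> //; left.
apply: (@conjugate_rep_gen R m Om k1 k2 k3 rho s (PSp_class (mkSp sph))) => i.
rewrite -Asigma -Lrho.
have -> : A s i = (mkSp sph * L i * (mkSp sph)^-1)%g.
  by apply/val_inj; rewrite /= LE -hA mulmxK.
rewrite !PSp_class_mulg; congr (_ * _)%g.
apply: (mulgI (PSp_class (mkSp sph))); rewrite mulgV -PSp_class_mulg mulgV; exact: erefl.
Qed.

(** Being a spin family is the vanishing of these six continuous functions of
    [S], hence a closed condition. *)
Definition spin_defect (S : 'I_3 -> 'M[R]_m) (j : 'I_6) : 'M[R]_m :=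
  [:: S 0 *m S 0 - 1%:M; S 1 *m S 1 - 1%:M; S 0 *m S 1 + S 1 *m S 0;
      (S 0)^T *m Om + Om *m S 0; (S 1)^T *m Om + Om *m S 1; S 2 - S 0 *m S 1]`_j.

Lemma spin_defectP (S : 'I_3 -> 'M[R]_m) :
  (forall j, spin_defect S j = 0) <->
  spin_pair Om (S 0) (S 1) /\ S =1 spin (S 0) (S 1).
Proof.
split=> [d0|[[EE FF EF EO FO] SE]].
  have e j (j6 : (j < 6)%N) := d0 (Ordinal j6).
  move: (e 0 isT) (e 1%N isT) (e 2 isT) (e 3 isT) (e 4 isT) (e 5 isT); rewrite /spin_defect /=.
  do 2 (move/eqP; rewrite subr_eq0 => /eqP ?).
  do 3 (move/eqP; rewrite addr_eq0 => /eqP ?).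
  move/eqP; rewrite subr_eq0 => /eqP S2; split; first by split.
  by elim/ord3_ind.
move=> [[|[|[|[|[|[|//]]]]]] j6]; rewrite /spin_defect /=.
- by rewrite EE subrr.
- by rewrite FF subrr.
- by rewrite EF addNr.
- by rewrite EO addNr.
- by rewrite FO addNr.
- by rewrite (SE 2) subrr.
Qed.

Lemma cvg_spin_defect (T : Type) (Fl : set_system T) (FFl : Filter Fl)
    (S : T -> 'I_3 -> 'M[R]_m) S0 j :
  (forall k, S x k @[x --> Fl] --> S0 k) ->
  spin_defect (S x) j @[x --> Fl] --> spin_defect S0 j.
Proof.
move=> SS; case: j => [[|[|[|[|[|[|//]]]]]] j6]; rewrite /spin_defect /=.
- by apply: cvgB; [exact: cvg_mulmx | exact: cvg_cst].
- by apply: cvgB; [exact: cvg_mulmx | exact: cvg_cst].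
- by apply: cvgD; exact: cvg_mulmx.
- by apply: cvgD; apply: cvg_mulmx; [exact: cvg_trmx|exact: cvg_cst|exact: cvg_cst|].
- by apply: cvgD; apply: cvg_mulmx; [exact: cvg_trmx|exact: cvg_cst|exact: cvg_cst|].
- by apply: cvgB => //; exact: cvg_mulmx.
Qed.

Definition flip (s : {ffun 'I_3 -> bool}) (X : 'I_3 -> 'M[R]_m) (i : 'I_3) :=
  (-1) ^+ s i *: X i.

(** The lifts of the generators to matrices are only defined up to sign; each
    of the finitely many sign patterns cuts out a closed condition. *)
Lemma spin_repP (rho : Hom) (A : 'I_3 -> Sp_pm Om) :
  (forall i, PSp_class (A i) = rho (gen i)) ->
  spin_rep rho <-> exists s, forall j,
    spin_defect (lincomb (invmx M) (flip s (fun i => val (A i)))) j = 0.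
Proof.
move=> Arho; split=> [[E [F [spinEF [L [LE Lrho]]]]]|[s /spin_defectP]].
  exists [ffun i => val (A i) != val (L i)]; apply/spin_defectP.
  set S := lincomb _ _.
  suff SE : S =1 spin E F.
    by split=> [|k]; rewrite !SE.
  move=> k; rewrite -[RHS]lincomb1 -(mulVmx unitM) -lincombM; apply: eq_lincomb => i.
  rewrite -LE /flip ffunE; case: eqP => [->|AL]; first by rewrite scale1r.
  have /PSp_class_eq[//|->] : PSp_class (A i) = PSp_class (L i) by rewrite Arho Lrho.
  by rewrite scalerN expr1 scaleN1r opprK.
set S := lincomb _ _ => -[spinS SE]; exists (S 0), (S 1); split=> //.
have sp i : Sp_set Om (lincomb M (spin (S 0) (S 1)) i).
  rewrite -(eq_lincomb M SE) lincombM mulmxV // lincomb1 /flip.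
  have := Sp_pmP (A i).
  case: (s i); rewrite ?scale1r // expr1 scaleN1r => -[uA AO].
  split; first by rewrite -scaleN1r unitmxZ ?unitrN1.
  have -> : (- val (A i))^T = - (val (A i))^T by apply/matrixP => k l; rewrite !mxE.
  by rewrite !mulNmx mulmxN opprK.
exists (fun i => mkSp (sp i)); split=> // i.
rewrite -Arho; apply/PSp_class_eq; rewrite /= -(eq_lincomb M SE) lincombM mulmxV // lincomb1 /flip.
by case: (s i); rewrite ?scale1r ?expr1 ?scaleN1r; [right | left].
Qed.

Lemma not_spin_rep_near (rho : Hom) : ~ spin_rep rho -> \forall sigma \near rho, ~ spin_rep sigma.
Proof.
move=> nrho; pose A1 i := PSp_repr (rho (gen i)).
have A1rho i : PSp_class (A1 i) = rho (gen i) by exact: PSp_reprK.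
have [A [Asigma Acvg]] := HomSpace_near_lifts A1rho.
have FF : Filter (nbhs rho) by exact: nbhs_filter.
pose K s sigma := forall j,
  spin_defect (lincomb (invmx M) (flip s (fun i => val (A sigma i)))) j = 0.
have H : \forall sigma \near rho, forall s, ~ K s sigma.
  apply: (@near_fin_forall _ _ (nbhs rho) FF (fun s sigma => ~ K s sigma)) => s; have : ~ forall j,
      spin_defect (lincomb (invmx M) (flip s (fun i => val (A1 i)))) j = 0.
    by move=> h; apply: nrho; apply/(spin_repP A1rho); exists s.
  move=> /existsNP[j dj].
  have lim : spin_defect (lincomb (invmx M) (flip s (fun i => val (A sigma i)))) j
      @[sigma --> rho] --> spin_defect (lincomb (invmx M) (flip s (fun i => val (A1 i)))) j.
    apply: cvg_spin_defect => k; apply: cvg_lincomb => i.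
    by apply: cvgZl_tmp; exact: Acvg.
  have dj0 : spin_defect (lincomb (invmx M) (flip s (fun i => val (A1 i)))) j != 0 by exact/eqP.
  have nz := cvgr_neq0 _ lim dj0.
  apply: (@filterS Hom (nbhs rho) FF _ _ _ (nz FF)) => sigma /= /eqP d0 Ks.
  exact: d0 (Ks j).
by apply: filterS H => sigma H /(spin_repP (Asigma sigma))[s]; exact: H.
Qed.

(** A limit of conjugates of [rho] is of spin type for the same [M], so its own
    class is open; this class meets that of [rho], hence equals it. *)
Lemma clopen_orbit (rho : Hom) : spin_rep rho ->
  open [set sigma | conjugate_rep rho sigma] /\ closed [set sigma | conjugate_rep rho sigma].
Proof.
move=> spinrho; split.
  rewrite openE => sigma rs; have := spin_rep_near_conj (spin_rep_conj spinrho rs).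
  by apply: filterS => tau; exact: conjugate_rep_trans.
move=> sigma clsigma.
have spinsigma : spin_rep sigma.
  apply: contrapT => /not_spin_rep_near /clsigma[tau [rt]]; apply.
  exact: spin_rep_conj spinrho rt.
have [tau [rt st]] := clsigma _ (spin_rep_near_conj spinsigma).
exact: conjugate_rep_trans rt (conjugate_rep_sym st).
Qed.

Lemma spin_rep_path (rho : R -> Hom) :
  {within `[0, 1], continuous rho} -> spin_rep (rho 0) ->
  forall t, t \in `[0, 1] -> conjugate_rep (rho 0) (rho t).
Proof.
move=> crho spin0 t t01; have [oO clO] := clopen_orbit spin0.
have cI : connected (rho @` `[0, 1]).
  by apply: connected_continuous_connected => //; exact: segment_connected.
have refl0 : conjugate_rep (rho 0) (rho 0) by exact/asboolP/conj_rel_refl.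
have i0 : `[0, 1]%classic (0 : R) by rewrite /= in_itv /= lexx ler01.
have sub : rho @` `[0, 1] `&` [set sigma | conjugate_rep (rho 0) sigma] = rho @` `[0, 1].
  apply: cI.
  - by exists (rho 0); split=> //; exists 0.
  - by exists [set sigma | conjugate_rep (rho 0) sigma].
  - by exists [set sigma | conjugate_rep (rho 0) sigma].
have : (rho @` `[0, 1]) (rho t) by exists t.
by rewrite -sub => -[].
Qed.

Definition char_class (rho : Hom) : char_variety (triangle_group k1 k2 k3) Om :=
  (\pi_{eq_quot (conj_equiv (triangle_group k1 k2 k3) Om)} rho)%qT.

Lemma char_classP (rho sigma : Hom) : char_class rho = char_class sigma <-> conjugate_rep rho sigma.
Proof.
split; first by move=> /eqmodP /asboolP.
by move=> rs; apply/eqmodP/asboolP.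
Qed.

Lemma isolated_spin_rep (rho : Hom) : spin_rep rho ->
  isolated [set: char_variety (triangle_group k1 k2 k3) Om] (char_class rho).
Proof.
move=> /clopen_orbit[oO _]; split; first by rewrite inE.
exists [set char_class rho]; last by rewrite setIT.
apply: open_nbhs_nbhs; split=> //.
rewrite /open /= /quotient_open -[X in open X]/(char_class @^-1` _).
rewrite (_ : _ @^-1` _ = [set sigma | conjugate_rep rho sigma]) //.
by apply/seteqP; split=> sigma /=; [move=> /esym /char_classP | move=> /char_classP].
Qed.

End SpinRepresentations.

(** * The diagonal representations *)

Section Standard.
Variable R : realType.

Definition E0 : 'M[R]_2 := \matrix_(i, j) (if i == j then (if i == 0 then 1 else -1) else 0).
Definition F0 : 'M[R]_2 := \matrix_(i, j) (i != j)%:R.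

Lemma ord2_ind (P : 'I_2 -> Prop) : P 0 -> P 1 -> forall k, P k.
Proof.
move=> P0 P1 [[|[|k]] // kk].
- by rewrite (_ : Ordinal kk = 0) //; apply/val_inj.
- by rewrite (_ : Ordinal kk = 1) //; apply/val_inj.
Qed.

Lemma mx2P (A B : 'M[R]_2) :
  A 0 0 = B 0 0 -> A 0 1 = B 0 1 -> A 1 0 = B 1 0 -> A 1 1 = B 1 1 -> A = B.
Proof. by move=> *; apply/matrixP; elim/ord2_ind; elim/ord2_ind. Qed.

Lemma mulmx2E (A B : 'M[R]_2) i j : (A *m B) i j = A i 0 * B 0 j + A i 1 * B 1 j.
Proof.
rewrite mxE big_ord_recl big_ord1; congr (_ * _ + A i _ * B _ j); exact/val_inj.
Qed.

Lemma omega2E : omega2 R = \matrix_(i, j) (if i == j then 0 else if i == 0 then 1 else -1).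
Proof.
apply/matrixP => i j; rewrite /omega2 !mxE.
case: splitP => i' ii'; rewrite !mxE; case: splitP => j' jj'; rewrite !mxE.
all: move: ii' jj'; rewrite !ord1 /= ?addn0 => ii' jj'.
all: by rewrite -!val_eqE /= ii' jj'.
Qed.

Lemma standard_spin_pair : spin_pair (omega2 R) E0 F0.
Proof.
have oppE (A : 'M[R]_2) i j : (- A) i j = - A i j by rewrite mxE.
by rewrite omega2E; split; apply: mx2P; rewrite ?oppE !mulmx2E !mxE /=; ring.
Qed.

Lemma tensmx1 (p q : nat) : (1%:M : 'M[R]_p) *t (1%:M : 'M[R]_q) = 1%:M.
Proof.
apply/matrixP => i j; case: (mxtens_indexP i) => i1 i2; case: (mxtens_indexP j) => j1 j2.
rewrite tensmxE !mxE -natrM mulnb -xpair_eqE; congr (nat_of_bool _)%:R.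
by rewrite -(inj_eq (can_inj (@mxtens_indexK p q))).
Qed.

Section DiagonalSpin.
Variables (n : nat) (b : 'M[R]_n) (P : 'M[R]_(2 * n)).
Hypothesis hP : symplectic_iso b P.

Definition diag_mxrep (A : 'M[R]_2) : 'M[R]_(2 * n) := P *m (A *t (1%:M : 'M[R]_n)) *m invmx P.

Lemma diag_mxrepM A B : diag_mxrep (A *m B) = diag_mxrep A *m diag_mxrep B.
Proof.
have [uP _] := hP; rewrite /diag_mxrep !mulmxA mulmxKV // -!mulmxA; congr (_ *m _).
by rewrite !mulmxA tensmx_mul mul1mx.
Qed.

Lemma diag_mxrep_lincomb M (X : 'I_3 -> 'M[R]_2) i :
  diag_mxrep (lincomb M X i) = lincomb M (fun k => diag_mxrep (X k)) i.
Proof.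
rewrite -lincomb_mulr -lincomb_mull; congr (_ *m _ *m _); apply/matrixP => k l.
rewrite !mxE !summxE big_distrl /=; apply: eq_bigr => s _.
by rewrite !mxE mulrA.
Qed.

Lemma diag_mxrepN A : diag_mxrep (- A) = - diag_mxrep A.
Proof.
rewrite /diag_mxrep -mulNmx -mulmxN; congr (_ *m _ *m _).
by apply/matrixP => k l; rewrite !mxE mulNr.
Qed.

Lemma diag_mxrep_skew A : A^T *m omega2 R = - (omega2 R *m A) ->
  (diag_mxrep A)^T *m omega_std R n = - (omega_std R n *m diag_mxrep A).
Proof.
have [uP PE] := hP => AO.
have key : P^T *m omega_std R n = (omega2 R *t b) *m invmx P by rewrite -PE mulmxK.
have key' : (invmx P)^T *m (omega2 R *t b) = omega_std R n *m P.
  by rewrite -PE !mulmxA trmx_inv mulVmx ?mul1mx // unitmx_tr.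
rewrite /diag_mxrep !trmx_mul trmx_tens trmx1 -!mulmxA key.
rewrite (mulmxA (A^T *t _)) tensmx_mul AO mul1mx.
have -> : (- (omega2 R *m A)) *t b = - ((omega2 R *t b) *m (A *t 1%:M)).
  by rewrite tensmx_mul mulmx1; apply/matrixP => k l; rewrite !mxE mulNr.
by rewrite mulNmx mulmxN !mulmxA key'.
Qed.

Lemma diag_spin_pair E F : spin_pair (omega2 R) E F ->
  spin_pair (omega_std R n) (diag_mxrep E) (diag_mxrep F).
Proof.
have [uP _] := hP => -[EE FF EF EO FO].
have d1 : diag_mxrep 1%:M = 1%:M by rewrite /diag_mxrep tensmx1 mulmx1 mulmxV.
split; rewrite -?diag_mxrepM -?diag_mxrepN ?EE ?FF ?EF ?diag_mxrepN //.
  exact: diag_mxrep_skew.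
exact: diag_mxrep_skew.
Qed.

Lemma spin_rep_diag (k1 k2 k3 : nat) M (rho : HomSpace (triangle_group k1 k2 k3) (omega2 R))
    (sigma : HomSpace (triangle_group k1 k2 k3) (omega_std R n)) :
  (forall i, val (PSp_repr (rho (gen k1 k2 k3 i))) = lincomb M (spin E0 F0) i) ->
  (forall x, sigma x = diag_rep hP (rho x)) -> spin_rep M sigma.
Proof.
move=> rhoM sigmaE; exists (diag_mxrep E0), (diag_mxrep F0); split.
  exact: diag_spin_pair standard_spin_pair.
exists (fun i => diag_lift hP (PSp_repr (rho (gen k1 k2 k3 i)))); split=> i.
  rewrite /= -[LHS]/(diag_mxrep _) rhoM diag_mxrep_lincomb; apply: eq_lincomb => k.
  by elim/ord3_ind: k; rewrite /spin //= diag_mxrepM.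
by rewrite sigmaE.
Qed.

End DiagonalSpin.

Lemma omega_std_skew n : (omega_std R n)^T = - omega_std R n.
Proof.
have O2 : (omega2 R)^T = - omega2 R.
  by rewrite omega2E; apply: mx2P; rewrite !mxE /=; ring.
rewrite /omega_std trmx_tens trmx1 O2.
by apply/matrixP => k l; rewrite !mxE mulNr.
Qed.

Lemma omega_std_unit n : omega_std R n \in unitmx.
Proof.
have O2 : omega2 R *m - omega2 R = 1%:M.
  by rewrite omega2E; apply: mx2P; rewrite !mulmx2E !mxE /=; ring.
have : omega_std R n *m ((- omega2 R) *t 1%:M) = 1%:M.
  by rewrite /omega_std tensmx_mul O2 mulmx1 tensmx1.
by case/mulmx1_unit.
Qed.

End Standard.

(** * Reflections of the hyperbolic plane *)

Section Geometry.
Variable R : realType.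
Local Notation C := (complex R).

(** A traceless matrix of determinant -1 acts as the reflection in the zero set
    of this function on the half-plane. *)
Definition mirror_eq (A : 'M[R]_2) (z : C) : R :=
  A 1 0 * (complex.Re z ^+ 2 + complex.Im z ^+ 2) - 2 * A 0 0 * complex.Re z - A 0 1.

Lemma geodesic_mirror (A : 'M[R]_2) (P : C) :
  A 0 0 ^+ 2 + A 0 1 * A 1 0 = 1 -> 0 < complex.Im P -> mirror_eq A P = 0 ->
  geodesic [set z | 0 < complex.Im z /\ mirror_eq A z = 0].
Proof.
move=> dA P0 AP; split; first by exists P.
exists (A 1 0), (- (2 * A 0 0)), (- A 0 1); split.
  move=> [A10 A00 A01]; move: dA.
  have -> : A 0 0 = 0 by lra.
  have -> : A 0 1 = 0 by lra.
  by rewrite expr0n mul0r addr0 => /eqP; rewrite eq_sym oner_eq0.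
by apply/seteqP; split=> z /= [z0 h]; split=> //; rewrite -?h /mirror_eq;
  move: h; rewrite /mirror_eq; lra.
Qed.

Lemma geodesic_through (P Q : C) : 0 < complex.Im P -> 0 < complex.Im Q ->
  exists2 l, geodesic l & l P /\ l Q.
Proof.
case: P => [x y]; case: Q => [x' y'] /= y0 y0'.
have [<-|xx'] := eqVneq x x'.
  exists [set z | 0 < complex.Im z /\
    0 * (complex.Re z ^+ 2 + complex.Im z ^+ 2) + 1 * complex.Re z + - x = 0].
    split; first by exists (Complex x y); split=> //=; lra.
    exists 0, 1, (- x); split=> // -[] /eqP; rewrite oner_eq0 //.
  by split; split=> //=; lra.
set v := - ((x ^+ 2 + y ^+ 2) - (x' ^+ 2 + y' ^+ 2)) / (x - x').
have vE : v * (x - x') = - ((x ^+ 2 + y ^+ 2) - (x' ^+ 2 + y' ^+ 2)).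
  by rewrite /v divfK // subr_eq0.
exists [set z | 0 < complex.Im z /\
    1 * (complex.Re z ^+ 2 + complex.Im z ^+ 2) + v * complex.Re z + (- (x ^+ 2 + y ^+ 2) - v * x) = 0].
  split; first by exists (Complex x y); split=> //=; lra.
  exists 1, v, (- (x ^+ 2 + y ^+ 2) - v * x); split=> // -[] /eqP; rewrite oner_eq0 //.
by split; split=> //=; lra.
Qed.

Lemma det2E (A : 'M[R]_2) : \det A = A 0 0 * A 1 1 - A 0 1 * A 1 0.
Proof.
rewrite (expand_det_row _ 0) big_ord_recl big_ord1 /cofactor !det_mx11 !mxE /=.
rewrite expr0 mul1r expr1 mulN1r mulrN.
by congr (A _ _ * A _ _ - A _ _ * A _ _); apply/val_inj.
Qed.

Lemma Sp2_det (A : Sp_pm (omega2 R)) : \det (val A) = 1 \/ \det (val A) = -1.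
Proof.
have [_ ] := Sp_pmP A; move: (val A) => {}A AO.
have E : A^T *m omega2 R *m A = \det A *: omega2 R.
  by rewrite det2E omega2E; apply: mx2P; rewrite !mulmx2E !mxE /=; ring.
move: AO; rewrite E => -[] /matrixP /(_ 0 1).
  by rewrite omega2E !mxE /= mulr1; left.
by rewrite omega2E !mxE /= mulr1; right.
Qed.

(** The real and imaginary parts of the fixed point equation, cleared of its
    denominator; [e] is -1 when the isometry conjugates its argument. *)
Lemma mobius_fixed (A : 'M[R]_2) (x y : R) : 0 < y -> mobius A (Complex x y) = Complex x y ->
  let e := if 0 < \det A then 1 else -1 in
  A 0 0 * x + A 0 1 = x * (A 1 0 * x + A 1 1) - y * (A 1 0 * (e * y)) /\
  A 0 0 * (e * y) = x * (A 1 0 * (e * y)) + y * (A 1 0 * x + A 1 1).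
Proof.
move=> y0; rewrite /mobius; set den := (X in _ / X = _); set num := (X in X / _ = _).
have [-> |den0] := eqVneq den 0.
  by rewrite invr0 mulr0 => -[_ /esym yE]; rewrite yE ltxx in y0.
move=> /(congr1 (fun z => z * den)); rewrite divfK // {}/num {den0}/den.
case: ifP => _; rewrite /= => -[] reE imE; split; move: reE imE;
  rewrite !(mul0r, addr0, subr0, add0r); lra.
Qed.

(** An isometry of determinant 1 with two fixed points is the identity, which
    the moved point [S] excludes. For determinant -1, the imaginary part of the
    fixed point equation says that the trace is 0, and the real part that the
    point lies on the mirror. *)
Lemma reflection_matrix (A : 'M[R]_2) (P Q S : C) :
  \det A = 1 \/ \det A = -1 -> 0 < complex.Im P -> 0 < complex.Im Q -> P <> Q ->
  mobius A P = P -> mobius A Q = Q -> mobius A S <> S ->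
  [/\ A 1 1 = - A 0 0, A 0 0 ^+ 2 + A 0 1 * A 1 0 = 1 & mirror_eq A P = 0 /\ mirror_eq A Q = 0].
Proof.
case: P => xP yP; case: Q => xQ yQ dA /= P0 Q0 PQ.
move=> /(mobius_fixed P0) /= fP /(mobius_fixed Q0) /= fQ nS.
case: dA => dA; move: fP fQ; rewrite dA ?ltr01 ?ltr0N1 => -[reP imP] [reQ imQ]; last first.
  have trA : A 1 1 = - A 0 0.
    have : yP * (A 1 1 + A 0 0) = 0 by lra.
    by move/eqP; rewrite mulf_eq0 gt_eqF //= addr_eq0 => /eqP.
  move: dA; rewrite det2E trA => dA; rewrite trA in reP reQ; rewrite /mirror_eq /=.
  by split=> //; [lra | split; lra].
exfalso; apply: nS.
have hP : 2 * (A 1 0 * xP) = A 0 0 - A 1 1.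
  have : yP * (2 * (A 1 0 * xP) - (A 0 0 - A 1 1)) = 0 by lra.
  by move/eqP; rewrite mulf_eq0 gt_eqF //= subr_eq0 => /eqP.
have hQ : 2 * (A 1 0 * xQ) = A 0 0 - A 1 1.
  have : yQ * (2 * (A 1 0 * xQ) - (A 0 0 - A 1 1)) = 0 by lra.
  by move/eqP; rewrite mulf_eq0 gt_eqF //= subr_eq0 => /eqP.
have A10 : A 1 0 = 0.
  apply/eqP/negPn/negP => A10; apply: PQ.
  have xx : xP = xQ by apply: (mulfI A10); lra.
  rewrite -{}xx in hQ reQ imQ *; congr Complex.
  have : A 1 0 * (yP ^+ 2 - yQ ^+ 2) = 0 by lra.
  move/eqP; rewrite mulf_eq0 (negPf A10) /= subr_eq0 eqrXn2 ?ltW // => /eqP //.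
have AA : A 1 1 = A 0 0 by move: hP; rewrite A10; lra.
have A01 : A 0 1 = 0 by move: reP; rewrite A10 AA; lra.
have A00 : A 0 0 != 0.
  by apply: contra_eqN dA => /eqP a0; rewrite det2E AA a0 A10 !mulr0 subrr eq_sym oner_eq0.
rewrite /mobius dA ltr01 A10 A01 AA mul0r add0r addr0 mulrAC divff ?mul1r //.
by rewrite -(inj_eq (@complexI R)) in A00.
Qed.

Definition coord (A : 'I_3 -> 'M[R]_2) : 'M[R]_3 :=
  \matrix_(i, k) [:: A i 0 0; (A i 0 1 + A i 1 0) / 2; (A i 0 1 - A i 1 0) / 2]`_k.

Lemma coord_lincomb (A : 'I_3 -> 'M[R]_2) i :
  A i 1 1 = - A i 0 0 -> A i = lincomb (coord A) (spin (E0 R) (F0 R)) i.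
Proof.
move=> tr0; rewrite /lincomb !big_ord_recl big_ord0 addr0.
have Z (X : 'M[R]_2) c k l : (c *: X) k l = c * X k l by rewrite mxE.
have D (X Y : 'M[R]_2) k l : (X + Y) k l = X k l + Y k l by rewrite mxE.
by rewrite /spin /=; apply: mx2P; rewrite !D !Z mulmx2E !mxE /= ?tr0; field.
Qed.

Lemma gram_coord (A : 'I_3 -> 'M[R]_2) i : gram (coord A) i i = A i 0 0 ^+ 2 + A i 0 1 * A i 1 0.
Proof.
rewrite /gram mxE !big_ord_recl big_ord0 addr0 !mxE !big_ord_recl !big_ord0 !addr0 !mxE /=.
by field.
Qed.

Lemma mirror_eq_sum (A : 'I_3 -> 'M[R]_2) (v : 'rV[R]_3) z :
  v *m coord A = 0 -> \sum_i v 0 i * mirror_eq (A i) z = 0.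
Proof.
move=> vA; have h k : \sum_i v 0 i * coord A i k = 0.
  by have := congr1 (fun B : 'rV_3 => B 0 k) vA; rewrite !mxE.
have h0 : \sum_i v 0 i * A i 0 0 = 0.
  by rewrite -[RHS](h 0); apply: eq_bigr => i _; rewrite !mxE.
have h1 : \sum_i v 0 i * A i 0 1 = 0.
  transitivity (\sum_i v 0 i * coord A i 1 + \sum_i v 0 i * coord A i 2).
    by rewrite -big_split; apply: eq_bigr => i _; rewrite !mxE /=; field.
  by rewrite !h addr0.
have h2 : \sum_i v 0 i * A i 1 0 = 0.
  transitivity (\sum_i v 0 i * coord A i 1 - \sum_i v 0 i * coord A i 2).
    by rewrite -sumrB; apply: eq_bigr => i _; rewrite !mxE /=; field.
  by rewrite !h subr0.
transitivity (\sum_i v 0 i * A i 1 0 * (complex.Re z ^+ 2 + complex.Im z ^+ 2)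
  - \sum_i v 0 i * A i 0 0 * (2 * complex.Re z) - \sum_i v 0 i * A i 0 1).
  by rewrite -!sumrB; apply: eq_bigr => i _; rewrite /mirror_eq; ring.
by rewrite -!mulr_suml h0 h1 h2 !mul0r !subr0.
Qed.

(** The coordinate matrix is invertible because the triangle is not degenerate:
    a linear relation between the reflections is one between the equations of
    their mirrors, and at each vertex two of these vanish and the third, that of
    the opposite side, does not. *)
Lemma geometric_spin (k1 k2 k3 : nat) (rho : HomSpace (triangle_group k1 k2 k3) (omega2 R)) :
  geometric_rep rho -> exists M, [/\ M \in unitmx, forall i, gram M i i = 1 &
    forall i, val (PSp_repr (rho (gen k1 k2 k3 i))) = lincomb M (spin (E0 R) (F0 R)) i].
Proof.
move=> [P [Q [S [[P0 Q0 S0 nPQS] _ [ga aP aS] [gb bP bQ] [gc cQ cS]]]]].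
pose A i := val (PSp_repr (rho (gen k1 k2 k3 i))).
have PQ : P <> Q.
  move=> PQ; have [l gl [lP lS]] := geodesic_through P0 S0.
  by apply: (nPQS _ gl); rewrite -PQ.
have PS : P <> S.
  move=> PS; have [l gl [lP lQ]] := geodesic_through P0 Q0.
  by apply: (nPQS _ gl); rewrite -PS.
have QS : Q <> S.
  move=> QS; have [l gl [lP lQ]] := geodesic_through P0 Q0.
  by apply: (nPQS _ gl); rewrite -QS.
have dA i : \det (A i) = 1 \/ \det (A i) = -1 by exact: Sp2_det.
have naQ : mobius (A 0) Q <> Q by move=> aQ; apply: (nPQS _ ga).
have nbS : mobius (A 1) S <> S by move=> bS; apply: (nPQS _ gb).
have ncP : mobius (A 2) P <> P by move=> cP; apply: (nPQS _ gc).
have [trA detA [mAP mAS]] := reflection_matrix (dA 0) P0 S0 PS aP.2 aS.2 naQ.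
have [trB detB [mBP mBQ]] := reflection_matrix (dA 1) P0 Q0 PQ bP.2 bQ.2 nbS.
have [trC detC [mCQ mCS]] := reflection_matrix (dA 2) Q0 S0 QS cQ.2 cS.2 ncP.
have nAQ : mirror_eq (A 0) Q != 0.
  by apply/eqP => m; apply: (nPQS _ (geodesic_mirror detA P0 mAP)).
have nBS : mirror_eq (A 1) S != 0.
  by apply/eqP => m; apply: (nPQS _ (geodesic_mirror detB P0 mBP)).
have nCP : mirror_eq (A 2) P != 0.
  by apply/eqP => m; apply: (nPQS _ (geodesic_mirror detC Q0 mCQ)).
exists (coord A); split; last first.
- by elim/ord3_ind; apply: coord_lincomb.
- by elim/ord3_ind; rewrite gram_coord.
rewrite unitmxE unitfE; apply/det0P => -[v v0 vA].
have sum3 z : v 0 0 * mirror_eq (A 0) z + v 0 1 * mirror_eq (A 1) z + v 0 2 * mirror_eq (A 2) z = 0.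
  rewrite -[RHS](mirror_eq_sum z vA) !big_ord_recl big_ord0 addr0 addrA.
  by congr (v _ _ * mirror_eq (A _) _ + v _ _ * mirror_eq (A _) _ + v _ _ * mirror_eq (A _) _);
    apply/val_inj.
have v00 : v 0 0 = 0.
  by have := sum3 Q; rewrite mBQ mCQ !mulr0 !addr0 => /eqP;
     rewrite mulf_eq0 (negPf nAQ) orbF => /eqP.
have v01 : v 0 1 = 0.
  by have := sum3 S; rewrite mAS mCS !mulr0 addr0 add0r => /eqP;
     rewrite mulf_eq0 (negPf nBS) orbF => /eqP.
have v02 : v 0 2 = 0.
  by have := sum3 P; rewrite mAP mBP !mulr0 !add0r => /eqP;
     rewrite mulf_eq0 (negPf nCP) orbF => /eqP.
by move/eqP: v0; apply; apply/rowP; elim/ord3_ind; rewrite mxE.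
Qed.

End Geometry.

(** * Mirrors with prescribed angles *)

Section Trigonometry.
Variable R : realType.
Implicit Types (a b c t : R).

(** Since [a + b < pi - c], [cos c + cos a cos b > sin a sin b >= 0]; square this. *)
Lemma hyperbolic_cos a b c : 0 <= a -> 0 <= b -> 0 <= c -> a + b + c < pi ->
  1 < cos a ^+ 2 + cos b ^+ 2 + cos c ^+ 2 + 2 * cos a * cos b * cos c.
Proof.
move=> a0 b0 c0 abc.
have sa : 0 <= sin a by apply: sin_ge0_pi; rewrite a0 /=; lra.
have sb : 0 <= sin b by apply: sin_ge0_pi; rewrite b0 /=; lra.
have key : sin a * sin b < cos c + cos a * cos b.
  have : cos (pi - c) < cos (a + b).
    by rewrite ltr_cos ?in_itv /=; [lra | apply/andP; split; lra | apply/andP; split; lra].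
  by rewrite cosB cospi sinpi mul0r addr0 mulN1r cosD; lra.
have : (sin a * sin b) ^+ 2 < (cos c + cos a * cos b) ^+ 2.
  by rewrite ltrXn2r // ?nnegrE ?mulr_ge0 //; apply: le_trans (ltW key); exact: mulr_ge0.
by rewrite exprMn !sin2cos2; nra.
Qed.

(** [Y] satisfies the characteristic equation of a rotation of angle [t], and
    its powers are computed by the same recurrence. *)
Lemma sin_expmx (m : nat) (Y : 'M[R]_m) t k : Y *m Y = (2 * cos t) *: Y - 1%:M ->
  sin t *: Y ^+ k.+1 = sin (k.+1%:R * t) *: Y - (sin (k%:R * t))%:M.
Proof.
move=> YY; elim: k => [|k IH].
  by rewrite expr1 mul1r mul0r sin0 raddf0 subr0.
rewrite exprS -[Y * _]/(Y *m _) scalemxAr IH mulmxBr -scalemxAr YY mul_mx_scalar.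
rewrite scalerBr scalerA scalemx1.
have -> : sin (k.+2%:R * t) = sin (k.+1%:R * t) * (2 * cos t) - sin (k%:R * t).
  have -> : k.+2%:R * t = k.+1%:R * t + t by rewrite -[k.+2]addn1 natrD mulrDl mul1r.
  have -> : k%:R * t = k.+1%:R * t - t by rewrite -[k.+1]addn1 natrD mulrDl mul1r addrK.
  by rewrite sinD sinB; ring.
by rewrite scalerBl addrAC.
Qed.

(** [- A B] behaves as a rotation of angle [pi / k], whose [k]-th power is -1. *)
Lemma reflections_order (m k : nat) (A B : 'M[R]_m) : (1 < k)%N ->
  A *m A = 1%:M -> B *m B = 1%:M ->
  A *m B + B *m A = (2 * - cos (pi / k%:R))%:M ->
  (A *m B) ^+ k = 1%:M \/ (A *m B) ^+ k = - 1%:M.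
Proof.
move=> k1 AA BB AB; set t := pi / k%:R in AB.
pose Y := - (A *m B).
have YY : Y *m Y = (2 * cos t) *: Y - 1%:M.
  have BA : B *m A = (2 * - cos t)%:M - A *m B by rewrite -AB addrC addKr.
  rewrite /Y mulNmx mulmxN opprK -mulmxA (mulmxA B) BA mulmxBl mulmxBr mul_scalar_mx.
  by rewrite -scalemxAr -mulmxA BB mulmx1 AA mulrN scaleNr scalerN.
have k0 : 0 < k%:R :> R by rewrite ltr0n ltnW.
have t0 : 0 < t by rewrite divr_gt0 // pi_gt0.
have tpi : t < pi by rewrite ltr_pdivrMr // ltr_pMr ?pi_gt0 // ltr1n.
have st : sin t != 0 by rewrite gt_eqF // sin_gt0_pi // t0 tpi.
have Yk : Y ^+ k = - 1%:M.
  case: k @t k1 AB YY k0 t0 tpi st => // k t k1 AB YY k0 t0 tpi st.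
  apply: (scalerI st); rewrite (sin_expmx k YY).
  have kt : k.+1%:R * t = pi by rewrite mulrC divfK // gt_eqF.
  have -> : k%:R * t = pi - t by rewrite -kt -[k.+1]addn1 natrD mulrDl mul1r addrK.
  by rewrite kt sinpi sinB sinpi cospi mul0r sub0r mulN1r opprK scale0r sub0r scalerN scalemx1.
have -> : (A *m B) ^+ k = (-1) ^+ odd k * Y ^+ k by rewrite signr_odd -exprNn /Y opprK.
rewrite Yk; case: (odd k); first by left; rewrite expr1 mulN1r opprK.
by right; rewrite expr0 mul1r.
Qed.

Lemma gramE (M : 'M[R]_3) i j :
  gram M i j = M i 0 * M j 0 + M i 1 * M j 1 - M i 2 * M j 2.
Proof.
have e1 : lift ord0 ord0 = 1 :> 'I_3 by apply/val_inj.
have e2 : lift ord0 (lift ord0 ord0) = 2 :> 'I_3 by apply/val_inj.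
rewrite /gram mxE !big_ord_recl big_ord0 addr0 !mxE !big_ord_recl !big_ord0 !addr0 !e1 !e2.
by rewrite !mxE /=; ring.
Qed.

(** The Gram matrix with diagonal 1 and these cosines has signature (2, 1) by
    [hyperbolic_cos], like [eta]; Gram-Schmidt then gives [M]. *)
Lemma hyperbolic_mirrors a b c : 0 < a < pi -> 0 <= b -> 0 <= c -> a + b + c < pi ->
  exists M : 'M[R]_3, [/\ M \in unitmx, forall i, gram M i i = 1 &
    [/\ gram M 0 1 = - cos a, gram M 1 2 = - cos b & gram M 0 2 = - cos c]].
Proof.
move=> /andP[a0 api] b0 c0 abc.
have := hyperbolic_cos (ltW a0) b0 c0 abc.
have s0 : 0 < sin a by rewrite sin_gt0_pi // a0.
have := sin2cos2 a; move: (cos a) (cos b) (cos c) (sin a) s0 => x z y s s0 s2 lt1.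
set D := x ^+ 2 + z ^+ 2 + y ^+ 2 + 2 * x * z * y - 1.
have D0 : 0 < D by rewrite /D; lra.
pose r := Num.sqrt D / s.
have r0 : 0 < r by rewrite divr_gt0 // sqrtr_gt0.
have r2 : (r * s) ^+ 2 = D by rewrite /r divfK ?gt_eqF // sqr_sqrtr // ltW.
(* The rows of M are the mirrors: the first is the first basis vector, the
   second lies in the plane of the first two, and the third is then determined
   by the Gram matrix. *)
pose w := - (z + x * y) / s.
have ws : w * s = - (z + x * y) by rewrite /w divfK // gt_eqF.
pose M : 'M[R]_3 := \matrix_(i, j)
  (if i == 0 then [:: 1; 0; 0]`_j else if i == 1 then [:: - x; s; 0]`_j else [:: - y; w; r]`_j).
exists M; split.
- have trM : is_trig_mx M.
    apply/is_trig_mxP => i j; rewrite !mxE.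
    by elim/ord3_ind: i; elim/ord3_ind: j.
  rewrite unitmxE (det_trig trM) unitfE; apply/prodf_neq0 => i _; rewrite mxE.
  by elim/ord3_ind: i => /=; rewrite ?oner_eq0 ?gt_eqF.
- elim/ord3_ind; rewrite gramE !mxE /=.
  + by ring.
  + by move: s2; lra.
  + have : s ^+ 2 * (- y * - y + w * w - r * r - 1) = 0.
      have -> : s ^+ 2 * (- y * - y + w * w - r * r - 1) =
        s ^+ 2 * (y ^+ 2 - 1) + (w * s) ^+ 2 - (r * s) ^+ 2 by ring.
      by rewrite ws r2 s2 /D; ring.
    by move/eqP; rewrite mulf_eq0 expf_eq0 gt_eqF //= subr_eq0 => /eqP.
- split; rewrite gramE !mxE /=; [by ring | | by ring].
  by rewrite [s * w]mulrC ws; ring.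
Qed.

Lemma hyperbolic_angles k1 k2 k3 : hyperbolic_triple k1 k2 k3 ->
  [/\ (1 < k1)%N, (1 < k2)%N, (1 < k3)%N &
   pi / k1%:R + pi / k2%:R + pi / k3%:R < pi :> R].
Proof.
move=> [k10 k20 k30 hk].
have p k : (0 < k)%N -> 0 < k%:R^-1 :> rat by move=> ?; rewrite invr_gt0 ltr0n.
have one k : (0 < k)%N -> k%:R^-1 < 1 :> rat -> (1 < k)%N.
  by move=> kp; rewrite invf_lt1 ?ltr0n // ltr1n.
have := p _ k10; have := p _ k20; have := p _ k30 => h3 h2 h1.
split; [by apply: one => //; lra | by apply: one => //; lra | by apply: one => //; lra |].
rewrite -!mulrDr -[ltRHS]mulr1 ltr_pM2l ?pi_gt0 //.
have : ratr (k1%:R^-1 + k2%:R^-1 + k3%:R^-1) < ratr 1 :> R by rewrite ltr_rat.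
by rewrite !rmorphD /= !fmorphV /= !ratr_nat rmorph1.
Qed.

End Trigonometry.

(** * Existence of spin representations *)

Section Existence.
Variables (R : realType) (m k1 k2 k3 : nat) (Om : 'M[R]_m).
Local Notation Hom := (HomSpace (triangle_group k1 k2 k3) Om).

Lemma eval_word_pow (G : groupType) (s : 'I_3 -> G) k w :
  eval_word s (word_pow k w) = (eval_word s w ^+ k)%g.
Proof.
elim: k => [//|k IH]; by rewrite /word_pow /= eval_word_cat -/(word_pow k w) IH expgS.
Qed.

Lemma spin_rep_exists (M : 'M[R]_3) (E F : 'M[R]_m) : spin_pair Om E F ->
  (forall i, gram M i i = 1) -> (1 < k1)%N -> (1 < k2)%N -> (1 < k3)%N ->
  gram M 0 1 = - cos (pi / k1%:R) -> gram M 1 2 = - cos (pi / k2%:R) ->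
  gram M 0 2 = - cos (pi / k3%:R) ->
  exists (rho : Hom) (L : 'I_3 -> Sp_pm Om),
    (forall i, val (L i) = lincomb M (spin E F) i) /\
    forall i, PSp_class (L i) = rho (gen k1 k2 k3 i).
Proof.
move=> spinEF gM1 k11 k21 k31 g01 g12 g02; set C := lincomb M (spin E F).
have cC : clifford (gram M) C by apply: clifford_lincomb; exact: spin_clifford spinEF.
have sC : skew_family Om C by apply: skew_lincomb; exact: spin_skew.
have CC i : C i *m C i = 1%:M.
  have := cC i i; rewrite gM1 mulr1 => h; apply/matrixP => k l.
  by have := congr1 (fun B : 'M[R]_m => B k l) h; rewrite !mxE; lra.
have spC i : Sp_set Om (C i).
  split; first by have /mulmx1_unit[] := CC i.
  by right; rewrite sC mulNmx -mulmxA CC mulmx1.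
pose L i := mkSp (spC i); pose s i := PSp_class (L i).
have sX i j k : (C i *m C j) ^+ k = 1%:M \/ (C i *m C j) ^+ k = - 1%:M ->
    ((s i * s j) ^+ k = 1)%g.
  by move=> h; rewrite -PSp_class_mulg -PSp_classX; apply/PSp_class1P; rewrite Sp_valX.
have s2 i : (s i ^+ 2 = 1)%g.
  by rewrite expg2 -[LHS]expg1; apply: sX; left; rewrite expr1 CC.
have s_rels r : triangle_relators k1 k2 k3 r -> eval_word s r = 1%g.
  rewrite /triangle_relators /= !inE.
  case/or4P => [/eqP->|/eqP->|/eqP->|]; try by rewrite eval_word_pow /= /eval_letter /= mulg1 s2.
  case/or3P => /eqP ->; rewrite eval_word_pow /= /eval_letter /= mulg1; apply: sX.
  - by apply: reflections_order; rewrite ?CC // cC g01.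
  - by apply: reflections_order; rewrite ?CC // cC g12.
  - by apply: reflections_order; rewrite ?CC // cC g02.
pose f : {ptws triangle_group k1 k2 k3 -> PSp_pm Om} := pres_lift s.
have fP : HomSpace_set f by move=> x y; exact: pres_liftM.
exists (exist _ f (mem_set fP)), L; split=> // i.
by rewrite /= /HomSpace_fun /= /f pres_lift_gen.
Qed.

(** Conjugating in the projective group may change the signs of the three
    mirrors. The Gram matrix forces the three signs to agree as soon as it has
    at most one vanishing off-diagonal entry; then a common sign -1 is excluded
    because the third basis element is the product of the first two. *)
Lemma conj_spin_intertwine (M : 'M[R]_3) (E F E' F' : 'M[R]_m) (rho rho' : Hom)
    (L L' : 'I_3 -> Sp_pm Om) :
  (0 < m)%N -> M \in unitmx ->
  (forall s : 'I_3 -> R, (forall i, s i = 1 \/ s i = -1) ->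
     (forall i j, s i * s j * gram M i j = gram M i j) -> forall i, s i = s 0) ->
  spin_pair Om E F -> spin_pair Om E' F' ->
  (forall i, val (L i) = lincomb M (spin E F) i) ->
  (forall i, PSp_class (L i) = rho (gen k1 k2 k3 i)) ->
  (forall i, val (L' i) = lincomb M (spin E' F') i) ->
  (forall i, PSp_class (L' i) = rho' (gen k1 k2 k3 i)) ->
  conjugate_rep rho rho' ->
  exists2 h, Sp_set Om h & h *m E = E' *m h /\ h *m F = F' *m h.
Proof.
move=> m0 uM signs spinEF spinEF' LE Lrho LE' Lrho' [g rhog].
pose h := val (PSp_repr g); have [uh hO] := Sp_pmP (PSp_repr g).
exists h => //; rewrite -/h in uh.
pose C := lincomb M (spin E F); pose C' := lincomb M (spin E' F').
have cC : clifford (gram M) C by apply: clifford_lincomb; exact: spin_clifford spinEF.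
have cC' : clifford (gram M) C' by apply: clifford_lincomb; exact: spin_clifford spinEF'.
have /choice[s sP] : forall i, exists e : R, (e = 1 \/ e = -1) /\ h *m C i = e *: (C' i *m h).
  move=> i; have : PSp_class (L' i * PSp_repr g)%g = PSp_class (PSp_repr g * L i)%g.
    by rewrite !PSp_class_mulg Lrho Lrho' rhog PSp_reprK -!mulgA mulVg mulg1.
  move=> /PSp_class_eq[]; rewrite /= LE LE' -/h -/(C i) -/(C' i) => hC.
    by exists 1; split; [left | rewrite scale1r hC].
  by exists (- 1); split; [right | rewrite scaleN1r hC opprK].
have sC i : h *m C i = s i *: (C' i *m h) by case: (sP i).
have s1 i : s i = 1 \/ s i = -1 by case: (sP i).
have sgram i j : s i * s j * gram M i j = gram M i j.
  have hCC k l : h *m (C k *m C l) = (s k * s l) *: (C' k *m C' l *m h).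
    by rewrite mulmxA sC -scalemxAl -mulmxA sC -scalemxAr scalerA mulmxA.
  have : h *m (C i *m C j + C j *m C i) = (s i * s j) *: ((C' i *m C' j + C' j *m C' i) *m h).
    by rewrite mulmxDr !hCC [s j * s i]mulrC -scalerDr mulmxDl.
  rewrite cC cC' mul_mx_scalar mul_scalar_mx scalerA => /(congr1 (fun B => B *m invmx h)).
  rewrite -!scalemxAl mulmxV // => /matrixP /(_ (Ordinal m0) (Ordinal m0)).
  by move: (gram M i j) => x; rewrite !mxE eqxx !mulr1 => eq2; lra.
have s0 i : s i = s 0 by apply: signs.
have hS k : h *m spin E F k = s 0 *: (spin E' F' k *m h).
  rewrite -[spin E F k]lincomb1 -[spin E' F' k]lincomb1 -(mulVmx uM) -!lincombM lincomb_mull.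
  rewrite lincomb_mulr /lincomb scaler_sumr; apply: eq_bigr => i _.
  by rewrite -/(lincomb M _ i) -/(C i) sC s0 !scalerA mulrC.
have := s1 0; have := hS 2; have := hS 0; have := hS 1; rewrite /spin /= => hF hE hG [] s01.
  by rewrite s01 !scale1r in hE hF.
case: spinEF' => EE FF _ _ _.
move: hG; rewrite mulmxA hE -scalemxAl -(mulmxA E') hF -scalemxAr scalerA s01 mulrNN mulr1.
rewrite scale1r mulmxA scaleN1r => /eqP; rewrite -addr_eq0 -mulr2n -scaler_nat scaler_eq0 pnatr_eq0 /=.
have [uE uF] : E' \in unitmx /\ F' \in unitmx.
  by split; [have [] := mulmx1_unit EE | have [] := mulmx1_unit FF].
have : E' *m F' *m h \in unitmx by rewrite !unitmx_mul uE uF uh.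
move=> u /eqP z; move: (mulmxV u); rewrite z mul0mx => /matrixP /(_ (Ordinal m0) (Ordinal m0)).
by rewrite !mxE eqxx => /eqP; rewrite eq_sym oner_eq0.
Qed.

End Existence.

(** * The signature as an invariant *)

Section Inertia.
Variables (R : realType) (N : nat).

(** One half of Sylvester's law. If the index of [d'] were larger, some nonzero
    vector [w] supported on the negative entries of [d'] would have an image [y]
    under [h] vanishing on those of [d]; the value of the form at [w] would be
    negative by [d'] and nonnegative by [d]. *)
Lemma inertia (d d' : 'rV[R]_N) (h : 'M[R]_N) :
  h^T *m diag_mx d *m h = diag_mx d' ->
  (#|[set i | (d' 0 i < 0)%R]%SET| <= #|[set i | (d 0 i < 0)%R]%SET|)%N.
Proof.
set n' := [set i | (d' 0 i < 0)%R]%SET; set n := [set i | (d 0 i < 0)%R]%SET => hd.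
rewrite leqNgt; apply/negP => nn.
pose Sel : 'M[R]_(#|n'|, N) := \matrix_(k, i) (enum_val k == i)%:R.
pose B : 'M[R]_(#|n'|, #|n|) := \matrix_(k, l) h (enum_val l) (enum_val k).
have : ~~ row_free B by rewrite /row_free neq_ltn (leq_ltn_trans (rank_leq_col B) nn).
rewrite -kermx_eq0 => /rowV0Pn[v /sub_kermxP vB v0].
pose w := v *m Sel; pose y := w *m h^T.
have wE i : w 0 i = \sum_k v 0 k * (enum_val k == i)%:R.
  by rewrite mxE; apply: eq_bigr => k _; rewrite mxE.
have wn (k : 'I_#|n'|) : w 0 (enum_val k) = v 0 k.
  rewrite wE (bigD1 k) //= eqxx mulr1 big1 ?addr0 // => l lk.
  by rewrite (inj_eq enum_val_inj) (negPf lk) mulr0.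
have wn' i : i \notin n' -> w 0 i = 0.
  move=> ni; rewrite wE big1 // => k _; case: eqP => [ki|_]; last by rewrite mulr0.
  by move: ni; rewrite -ki enum_valP.
have yn i : i \in n -> y 0 i = 0.
  move=> ni; transitivity ((v *m B) 0 (enum_rank_in ni i)); last by rewrite vB mxE.
  rewrite mxE [RHS]mxE.
  transitivity (\sum_j \sum_k v 0 k * (enum_val k == j)%:R * h i j).
    by apply: eq_bigr => j _; rewrite wE mulr_suml; apply: eq_bigr => k _; rewrite mxE.
  rewrite exchange_big; apply: eq_bigr => k _ /=; rewrite mxE enum_rankK_in //.
  rewrite (bigD1 (enum_val k)) //= eqxx mulr1 big1 ?addr0 // => j jk.
  by rewrite eq_sym (negPf jk) mulr0 mul0r.
have qE (u e : 'rV[R]_N) : (u *m diag_mx e *m u^T) 0 0 = \sum_i e 0 i * u 0 i ^+ 2.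
  by rewrite mxE; apply: eq_bigr => i _; rewrite mul_mx_diag !mxE; ring.
have : (w *m diag_mx d' *m w^T) 0 0 = (y *m diag_mx d *m y^T) 0 0.
  by rewrite -hd /y (trmx_mul w h^T) trmxK !mulmxA.
rewrite !qE => q.
have : 0 <= \sum_i d 0 i * y 0 i ^+ 2.
  apply: sumr_ge0 => i _; have [ni|] := boolP (i \in n); first by rewrite yn // expr0n mulr0.
  by rewrite inE -leNgt => d0; rewrite mulr_ge0 // sqr_ge0.
rewrite -q; apply/negP; rewrite -ltNge.
have /rV0Pn[k vk] := v0.
rewrite (bigD1 (enum_val k)) //= wn.
have dk : d' 0 (enum_val k) < 0 by have := enum_valP k; rewrite inE.
apply: (@le_lt_trans _ _ (d' 0 (enum_val k) * v 0 k ^+ 2)); last first.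
  by rewrite nmulr_rlt0 // lt0r sqrf_eq0 vk sqr_ge0.
rewrite gerDl; apply: sumr_le0 => i _.
have [ni|/wn' ->] := boolP (i \in n'); last by rewrite expr0n mulr0.
by move: ni; rewrite inE => ni; rewrite nmulr_rle0 // sqr_ge0.
Qed.

End Inertia.

Section SignedSpin.
Variables (R : realType) (n : nat).

Definition signs (q : nat) : 'rV[R]_n := \row_i (if (i < q)%N then -1 else 1).

Lemma signs_sq q : diag_mx (signs q) *m diag_mx (signs q) = 1%:M.
Proof.
rewrite mul_diag_mx; apply/matrixP => i j; rewrite !mxE.
case: eqP => [->|_]; last by rewrite !mulr0n mulr0.
by rewrite !mulr1n; case: ifP => _; rewrite ?mulr1 // mulrNN mulr1.
Qed.

(** The diagonal representation on [R^2 (x) R^n] with form [omega2 (x) diag (signs q)],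
    transported to the standard symplectic form. *)
Definition spinE : 'M[R]_(2 * n) := E0 R *t 1%:M.
Definition spinF (q : nat) : 'M[R]_(2 * n) := F0 R *t diag_mx (signs q).

Lemma signed_spin_pair q : spin_pair (omega_std R n) spinE (spinF q).
Proof.
have [EE FF EF EO FO] := standard_spin_pair R.
have tensN (X : 'M[R]_2) (Y : 'M[R]_n) : (- X) *t Y = - (X *t Y).
  by apply/matrixP => k l; rewrite !mxE mulNr.
by split; rewrite /spinE /spinF /omega_std ?trmx_tens ?tr_diag_mx ?trmx1 !tensmx_mul
  ?signs_sq ?mul1mx ?mulmx1 ?EE ?FF ?EF ?EO ?FO ?tensN ?tensmx1.
Qed.

Definition signs2 q : 'rV[R]_(2 * n) := \row_r signs q 0 (mxtens_unindex r).2.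

Lemma omega_spinEF q : omega_std R n *m (spinE *m spinF q) = - diag_mx (signs2 q).
Proof.
have O : omega2 R *m (E0 R *m F0 R) = - 1%:M.
  have oppE (A : 'M[R]_2) i j : (- A) i j = - A i j by rewrite mxE.
  by rewrite omega2E; apply: mx2P; rewrite ?oppE !mulmx2E !mxE /=; ring.
rewrite /spinE /spinF /omega_std !tensmx_mul O !mul1mx.
apply/matrixP => i j; case: (mxtens_indexP i) => i1 i2; case: (mxtens_indexP j) => j1 j2.
rewrite tensmxE !mxE mxtens_indexK /= (inj_eq (can_inj (@mxtens_indexK 2 n))) xpair_eqE.
by case: eqP => _; case: eqP => _ /=; rewrite ?mulr1n ?mulr0n; ring.
Qed.

Lemma card_signs2 (P : pred 'I_n) :
  #|[set r : 'I_(2 * n) | P (mxtens_unindex r).2]%SET| = (2 * #|P|)%N.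
Proof.
transitivity #|[set p : 'I_2 * 'I_n | P p.2]%SET|.
  rewrite -(card_imset _ (can_inj (@mxtens_unindexK 2 n))); apply: eq_card => p.
  rewrite !inE; apply/imsetP/idP => [[r]|Pp]; first by rewrite inE => ? ->.
  by exists (mxtens_index p); rewrite ?inE mxtens_indexK.
transitivity (#|{: 'I_2}| * #|P|)%N; last by rewrite card_ord.
by rewrite -cardX; apply: eq_card => -[i j]; rewrite !inE.
Qed.

Lemma card_ltn_ord q : (q <= n)%N -> #|[pred i : 'I_n | (i < q)%N]| = q.
Proof.
by move=> qn; rewrite -sum1_card -(big_ord_widen n (fun=> 1%N) qn) sum1_card card_ord.
Qed.

(** Up to sign, [h] is an isometry between the symmetric forms [- Om E F], of
    index [2 q] and [2 q']. If it reverses the sign, inertia gives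
    [n - q <= q'], which suffices since [2 q <= n]. *)
Lemma signed_spin_index (q q' : nat) (h : 'M[R]_(2 * n)) :
  (2 * q <= n)%N -> (2 * q' <= n)%N -> Sp_set (omega_std R n) h ->
  h *m spinE = spinE *m h -> h *m spinF q = spinF q' *m h -> (q <= q')%N.
Proof.
move=> qn q'n [uh hO] hE hF.
have hEF : spinE *m spinF q' *m h = h *m (spinE *m spinF q).
  by rewrite -mulmxA -hF !mulmxA hE.
have hd : h^T *m diag_mx (signs2 q') *m h = diag_mx (signs2 q) \/
    h^T *m diag_mx (signs2 q') *m h = diag_mx (- signs2 q).
  have -> : h^T *m diag_mx (signs2 q') *m h = - (h^T *m omega_std R n *m h *m (spinE *m spinF q)).
    by rewrite -[diag_mx _]opprK -omega_spinEF mulmxN mulNmx -!mulmxA !(mulmxA spinE) hEF !mulmxA.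
  case: hO => ->; [left | right].
    by rewrite omega_spinEF opprK.
  by rewrite mulNmx omega_spinEF opprK raddfN.
have neg q0 : (2 * q0 <= n)%N -> #|[set r | (signs2 q0 0 r < 0)%R]%SET| = (2 * q0)%N.
  move=> q0n; rewrite -[RHS]/(2 * q0)%N -[in RHS](@card_ltn_ord q0) ?(leq_trans _ q0n) ?leq_pmull //.
  rewrite -card_signs2; apply: eq_card => r; rewrite !inE !mxE.
  by case: ifP; rewrite ?ltrN10 ?ltr10.
case: hd => /inertia; rewrite (neg q') //; first by rewrite neg // leq_pmul2l.
have -> : #|[set r | ((- signs2 q) 0 r < 0)%R]%SET| = (2 * (n - q))%N.
  have -> : (n - q)%N = #|[pred i : 'I_n | ~~ (i < q)%N]|.
    have := cardC [pred i : 'I_n | (i < q)%N]; rewrite card_ltn_ord ?card_ord;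
      last by apply: leq_trans qn; rewrite leq_pmull.
    by move=> nE; rewrite -[in LHS]nE addKn; apply: eq_card.
  rewrite -card_signs2; apply: eq_card => r; rewrite !inE !mxE.
  by case: ifP; rewrite ?opprK ?ltr10 ?ltrN10.
rewrite leq_pmul2l // => h1; apply: leq_trans h1.
by rewrite leq_subRL ?addnn -?mul2n // (leq_trans _ qn) // leq_pmull.
Qed.

End SignedSpin.

(** * Isolated points of the character variety *)

(** If two of the signs differ, two of the three cosines vanish, and the first
    hypothesis says that the square of the third exceeds 1. *)
Lemma gram_signs (R : realType) (M : 'M[R]_3) (a b c : R) :
  1 < cos a ^+ 2 + cos b ^+ 2 + cos c ^+ 2 + 2 * cos a * cos b * cos c ->
  gram M 0 1 = - cos a -> gram M 1 2 = - cos b -> gram M 0 2 = - cos c ->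
  forall s : 'I_3 -> R, (forall i, s i = 1 \/ s i = -1) ->
    (forall i j, s i * s j * gram M i j = gram M i j) -> forall i, s i = s 0.
Proof.
move=> lt1 g01 g12 g02 s s1 sg.
have cos2 t : cos t ^+ 2 <= 1 :> R by rewrite -(cos2Dsin2 t) lerDl sqr_ge0.
have := sg 0 1; have := sg 1 2; have := sg 0 2; rewrite g01 g12 g02.
move: (cos2 a) (cos2 b) (cos2 c) lt1; move: (cos a) (cos b) (cos c) => x z y hx hz hy lt1 h02 h12 h01.
by elim/ord3_ind => //; case: (s1 0) (s1 1) (s1 2) => e0 [] e1 [] e2;
  rewrite ?e0 ?e1 ?e2 // in h01 h12 h02 *; nra.
Qed.

(** The classes for [q = 0, ..., n / 2] are isolated and pairwise distinct. *)
Lemma char_variety_isolated (R : realType) (k1 k2 k3 n : nat) :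
  hyperbolic_triple k1 k2 k3 -> (1 <= n)%N ->
  (`I_(uphalf (n + 1)) #<=
     isolated [set: char_variety (triangle_group k1 k2 k3) (omega_std R n)])%card.
Proof.
move=> hk n0; have [k11 k21 k31 angles] := hyperbolic_angles R hk.
have pk k : (1 < k)%N -> 0 < pi / k%:R :> R.
  by move=> k1'; rewrite divr_gt0 ?pi_gt0 // ltr0n ltnW.
have a0 := pk _ k11; have b0 := pk _ k21; have c0 := pk _ k31.
have apk : 0 < (pi / k1%:R : R) < pi by rewrite a0 /=; lra.
have [M [uM gM1 [g01 g12 g02]]] := hyperbolic_mirrors apk (ltW b0) (ltW c0) angles.
have signsM := gram_signs (hyperbolic_cos (ltW a0) (ltW b0) (ltW c0) angles) g01 g12 g02.
have m0 : (0 < 2 * n)%N by rewrite muln_gt0.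
have /choice[rho rhoP] : forall q, exists rho : HomSpace (triangle_group k1 k2 k3) (omega_std R n),
    exists L : 'I_3 -> Sp_pm (omega_std R n),
    (forall i, val (L i) = lincomb M (spin (spinE R n) (spinF R n q)) i) /\
    forall i, PSp_class (L i) = rho (gen k1 k2 k3 i).
  by move=> q; apply: spin_rep_exists => //; exact: signed_spin_pair.
have conj_le q q' : (2 * q <= n)%N -> (2 * q' <= n)%N -> conjugate_rep (rho q) (rho q') -> (q <= q')%N.
  move=> qn q'n; have [L [LE Lrho]] := rhoP q; have [L' [LE' Lrho']] := rhoP q'.
  move=> /(conj_spin_intertwine m0 uM signsM (signed_spin_pair R n q)
     (signed_spin_pair R n q') LE Lrho LE' Lrho')[h sph [hE hF]].
  exact: signed_spin_index qn q'n sph hE hF.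
pose f q := char_class (rho q).
have fI : {in `I_(uphalf (n + 1)) &, injective f}.
  have small q : q \in `I_(uphalf (n + 1)) -> (2 * q <= n)%N.
    by rewrite inE /= addn1 uphalfE /= ltnS geq_half_double -mul2n.
  move=> q q' /small qn /small q'n /char_classP c; apply/eqP; rewrite eqn_leq.
  by rewrite conj_le //= conj_le //; exact: conjugate_rep_sym.
rewrite -(card_le_eql (inj_card_eq fI)); apply: subset_card_le => _ [q _ <-].
apply: (@isolated_spin_rep R (2 * n) k1 k2 k3 (omega_std R n) M) => //.
- exact: omega_std_skew.
- exact: omega_std_unit.
- exact: ltnW.
- exact: ltnW.
- exact: ltnW.
by exists (spinE R n), (spinF R n q); split; [exact: signed_spin_pair | exact: rhoP].
Qed.

Theorem theorem2 (R : realType) (k1 k2 k3 n : nat)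
    (hk : hyperbolic_triple k1 k2 k3) (hn : (1 <= n)%N) :
  (forall (rho_geom : HomSpace (triangle_group k1 k2 k3) (omega2 R)),
     geometric_rep rho_geom ->
   forall (p q : nat), (p + q)%N = n ->
   forall (b : 'M[R]_n), has_signature b p q ->
   forall (P : 'M[R]_(2 * n)) (hP : symplectic_iso b P),
   forall (rho : R -> HomSpace (triangle_group k1 k2 k3) (omega_std R n)),
     {within `[0, 1], continuous rho} ->
     (forall x, rho 0 x = diag_rep hP (rho_geom x)) ->
   forall t : R, t \in `[0, 1] -> conjugate_rep (rho 0) (rho t))
  /\
  (`I_(uphalf (n + 1)) #<=
     isolated [set: char_variety (triangle_group k1 k2 k3) (omega_std R n)])%card.
Proof.
split; last exact: char_variety_isolated.
move=> rho_geom /geometric_spin[M [uM gM1 rhoM]] p q _ b _ P hP rho crho rho0.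
have [k10 k20 k30 _] := hk.
apply: (@spin_rep_path R (2 * n) k1 k2 k3 (omega_std R n) M) => //.
- by rewrite muln_gt0.
- exact: omega_std_skew.
- exact: omega_std_unit.
exact: spin_rep_diag rhoM rho0.
Qed.
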